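(* For every real $u>1$ and every positive integer $d$ there exists $k>1$, depending only on $u$ and $d$, with the following property. Let $K\neq\{e\}$ be a finitely generated torsion-free group such that every finitely generated subgroup $H$ of $K$ either satisfies $\omega(H)\geq u$ or is isomorphic to $\mathbb{Z}^n$ for some $0\leq n\leq d$. Then for any non-proper HNN extension $G=K\rtimes_\alpha\mathbb{Z}$, where $\alpha$ is an automorphism of $K$ having no periodic conjugacy classes, we have $\omega(G)\geq k$.
   Context: For a finitely generated group $G$ and a finite generating set $A$ of $G$, let $\gamma_A(n)$ be the number of elements of $G$ of word length at most $n$ with respect to $A\cup A^{-1}$, and let $\omega(G,A)=\lim_{n\to\infty}\gamma_A(n)^{1/n}$ (the limit exists since $\gamma_A$ is submultiplicative). The growth constant of $G$ is $\omega(G)=\inf_A \omega(G,A)$, the infimum being over all finite generating sets $A$ of $G$. For an automorphism $\alpha$ of $K$, the non-proper HNN extension is $K\rtimes_\alpha\mathbb{Z}=\langle K,t\mid tkt^{-1}=\alpha(k)\ (k\in K)\rangle$. An automorphism $\alpha$ of $K$ has a periodic conjugacy class if there exist a non-identity element $x\in K$ and a non-zero integer $n$ such that $\alpha^n(x)$ is conjugate to $x$ in $K$. *)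

(* Defs.v *)
From HB Require Import structures.
From mathcomp Require Import all_boot all_order all_algebra finmap.
From mathcomp Require Import mathcomp_extra boolp classical_sets functions.
From mathcomp Require Import cardinality reals topology normedtype sequences exp.

Set Implicit Arguments.
Unset Strict Implicit.
Unset Printing Implicit Defensive.

Import Order.TTheory GRing.Theory Num.Theory.
Import numFieldNormedType.Exports.

Local Open Scope classical_set_scope.
Local Open Scope ring_scope.

(** A subgroup [H] of [G] is a subset of [G].  Word lengths with respect to a
    generating set of [H] are the same computed in [H] or in [G], so growth is
    defined for subgroups without a type for [H]; the group [G] itself is
    [[set: G]]. *)

Section Growth.
Variable G : groupType.
Implicit Types (A : {fset G}) (H : set G).

Definition is_subgroup H : Prop :=
  H 1%g /\ forall x y, H x -> H y -> H (x / y)%g.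

Definition generated A : set G := smallest is_subgroup [set` A].

Definition finitely_generated H : Prop := exists A, generated A = H.

Definition ball A (n : nat) : set G :=
  [set g | exists w : seq G,
     [/\ (size w <= n)%N,
         {in w, forall x, x \in A \/ (x^-1)%g \in A}
       & g = (\prod_(x <- w) x)%g]].

Lemma ball_finite A n : finite_set (ball A n).
Proof.
elim: n => [|n IHn].
  apply: (@sub_finite_set _ _ [set 1%g]); last exact: finite_set1.
  move=> g [w [w0 _ ->]]; move: w0; rewrite leqn0 size_eq0 => /eqP ->.
  by rewrite /= big_nil.
set S : set G := [set` A] `|` [set (x^-1)%g | x in [set` A]].
have finS : finite_set S.
  by rewrite finite_setU; split; last apply: finite_image; exact: finite_fset.
apply: (@sub_finite_set _ _
  ([set 1%g] `|` [set (x * y)%g | x in S & y in ball A n])); last first.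
  by rewrite finite_setU; split; [exact: finite_set1|exact: finite_image2].
move=> g [[|x w] [wn wA ->]]; first by left; rewrite big_nil.
right; exists x; last exists (\prod_(y <- w) y)%g; last by rewrite big_cons.
  have [xA|xA] := wA x (mem_head _ _); first by left.
  by right; exists (x^-1)%g => //; rewrite invgK.
by exists w; split=> // y yw; apply: wA; rewrite inE yw orbT.
Qed.

Definition growth_function A (n : nat) : nat := #|` fset_set (ball A n)|.

(* The term of index 0 is [_ `^ 0^-1 = _ `^ 0 = 1] and is irrelevant. *)
Definition growth_rate (R : realType) A : R :=
  limn (fun n : nat => (growth_function A n)%:R `^ n%:R^-1 : R).

Definition growth_constant (R : realType) H : R :=
  inf [set growth_rate R A | A in [set A | generated A = H]].

Definition torsion_free : Prop :=
  forall (x : G) (n : nat), (0 < n)%N -> (x ^+ n)%g = 1%g -> x = 1%g.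

Definition isomorphic_to_Zn (n : nat) H : Prop :=
  exists f : 'rV[int]_n -> G,
    {morph f : x y / x + y >-> (x * y)%g} /\ set_bij [set: 'rV[int]_n] H f.

End Growth.

Arguments growth_constant {G} R H.
Arguments growth_rate {G} R A.
Arguments torsion_free G : clear implicits.

Record automorphism (K : groupType) := Automorphism {
  aut :> K -> K;
  autV : K -> K;
  autM : {morph aut : x y / (x * y)%g};
  autK : cancel aut autV;
  autVK : cancel autV aut
}.

Section Automorphisms.
Variables (K : groupType) (alpha : automorphism K).

Definition aut_pow (n : int) : K -> K :=
  match n with
  | Posz m => iter m alpha
  | Negz m => iter m.+1 (autV alpha)
  end.

Definition has_periodic_conjugacy_class : Prop :=
  exists (x : K) (n : int),
    [/\ x != 1%g, n != 0 & exists y : K, aut_pow n x = (x ^ y)%g].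

Lemma autVM : {morph autV alpha : x y / (x * y)%g}.
Proof. by move=> x y; rewrite -{1}(autVK alpha x) -{1}(autVK alpha y) -autM autK. Qed.

Lemma aut_powM n : {morph aut_pow n : x y / (x * y)%g}.
Proof.
case: n => n x y /=; first by elim: n => //= n ->; rewrite autM.
by rewrite -autVM; congr autV; elim: n => //= n ->; rewrite autVM.
Qed.

Lemma aut_powS n x : aut_pow (n + 1) x = alpha (aut_pow n x).
Proof.
case: n => [n|[|n]].
- by rewrite -PoszD addn1.
- by rewrite /= autVK.
have -> : Negz n.+1 + 1 = Negz n.
  by rewrite !NegzE -[in n.+2]addn1 PoszD opprD addrNK.
by rewrite /= autVK.
Qed.

Lemma aut_powP n x : aut_pow (n - 1) x = autV alpha (aut_pow n x).
Proof. by rewrite -[in RHS](subrK 1 n) aut_powS autK. Qed.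

Lemma aut_powD m n x : aut_pow (m + n) x = aut_pow m (aut_pow n x).
Proof.
elim: m x => [|m IHm|m IHm] x; first by rewrite add0r.
  by rewrite -addn1 PoszD addrAC !aut_powS IHm.
by rewrite -addn1 PoszD opprD addrAC !aut_powP IHm.
Qed.

Lemma aut_pow1 n : aut_pow n 1%g = 1%g.
Proof. by apply: (@mulgI _ (aut_pow n 1%g)); rewrite -aut_powM !mulg1. Qed.

End Automorphisms.

(** The non-proper HNN extension [K ><|_alpha Z], as a semidirect product: the
    pair [(k, n)] stands for [k * t ^ n], so that
    [(k, m) * (l, n) = (k * alpha^m(l), m + n)]. *)

Definition hnn (K : groupType) (alpha : automorphism K) : Type :=
  (K * int)%type.

Section HNN.
Variables (K : groupType) (alpha : automorphism K).

Definition hnn_one : hnn alpha := (1%g, 0).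
Definition hnn_inv (x : hnn alpha) : hnn alpha :=
  (aut_pow alpha (- x.2) (x.1^-1)%g, - x.2).
Definition hnn_mul (x y : hnn alpha) : hnn alpha :=
  ((x.1 * aut_pow alpha x.2 y.1)%g, x.2 + y.2).

Lemma hnn_mulA : associative hnn_mul.
Proof.
move=> x y z; rewrite /hnn_mul /=; congr pair; last exact: addrA.
by rewrite aut_powM aut_powD mulgA.
Qed.

Lemma hnn_mul1g : left_id hnn_one hnn_mul.
Proof. by case=> k n; rewrite /hnn_mul /= mul1g add0r. Qed.

Lemma hnn_mulg1 : right_id hnn_one hnn_mul.
Proof. by case=> k n; rewrite /hnn_mul /= aut_pow1 mulg1 addr0. Qed.

Lemma hnn_mulVg : left_inverse hnn_one hnn_inv hnn_mul.
Proof.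
by case=> k n; rewrite /hnn_mul /hnn_inv /= -aut_powM mulVg aut_pow1 addNr.
Qed.

Lemma hnn_mulgV : right_inverse hnn_one hnn_inv hnn_mul.
Proof.
by case=> k n; rewrite /hnn_mul /hnn_inv /= -aut_powD subrr /= mulgV.
Qed.

HB.instance Definition _ := Choice.copy (hnn alpha) (K * int)%type.
HB.instance Definition _ := isGroup.Build (hnn alpha)
  hnn_mulA hnn_mul1g hnn_mulg1 hnn_mulVg hnn_mulgV.

Definition hnn_base (k : K) : hnn alpha := (k, 0).
Definition hnn_t : hnn alpha := (1%g, 1).

Lemma hnn_baseM : {morph hnn_base : x y / (x * y)%g}.
Proof. by []. Qed.

Lemma hnn_conj k : (hnn_t * hnn_base k * hnn_t^-1)%g = hnn_base (alpha k).
Proof.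
by congr pair; rewrite /= mul1g autVK invg1 mulg1.
Qed.

End HNN.

(* Main.v *)
Require Import Defs.
From HB Require Import structures.
From mathcomp Require Import all_boot all_order all_algebra finmap.
From mathcomp Require Import boolp classical_sets cardinality reals.
From mathcomp Require Import topology normedtype sequences exp.
From mathcomp Require Import algC algnum zify lra.

(** Write [G] for the extension and let [A] generate it.  Since [alpha] has no
    periodic conjugacy class, [G] is not abelian and [A] contains some [s] with
    nonzero [t]-exponent, so that a commutator [x <> 1] of two elements of [A] lies
    in [K].  Let [beta] be conjugation by [s] on [K] and [x_i = beta^i x].

    If for some bounded [m] all the products of the [x_{mk}^{e_k}], with [e_k] in
    [{0, 1}], are distinct, then the words [x^{e_0} s^m x^{e_1} s^m ...] give
    uniform exponential growth; the same happens if [<x_0, ..., x_d>] has growth at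
    least [u].  Otherwise [x_0, ..., x_d] commute and satisfy a relation with
    primitive coefficient polynomial [P].  A collision for [m = 1] makes
    [L = <x_i, i in Z>] finitely generated, [P] makes some power [x^M] central in
    [L], and a Nakayama argument modulo [M] with the primitive [P] puts [x_d] in
    [<x_0, ..., x_{d-1}>] times the centre of [L]: hence [L] is abelian.  It is
    then a quotient of [Z[X]] by an ideal all of whose elements have a common root
    [z].  The collisions for larger [m] bound the conjugates of the [z^m] by [2],
    so [z] is a root of unity as in Kronecker's theorem, and some power of [beta]
    fixes a nontrivial element of [L], which contradicts the hypothesis on
    [alpha]. *)

Set Implicit Arguments.
Unset Strict Implicit.
Unset Printing Implicit Defensive.

Import Order.TTheory GRing.Theory Num.Theory.
Import numFieldNormedType.Exports.

Local Open Scope classical_set_scope.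
Local Open Scope ring_scope.

(* [topology] has its own [ball]. *)
Local Notation ball := Defs.ball.

(** * Algebraic numbers whose powers are roots of small polynomials *)

Lemma linear_dependence (F : fieldType) (k n : nat) (A : 'M[F]_(k, n)) :
  (n < k)%N -> exists2 c : 'rV[F]_k, c != 0 & c *m A = 0.
Proof.
move=> nk; have : kermx A != 0.
  by rewrite -mxrank_eq0 mxrank_ker subn_eq0 -ltnNge (leq_ltn_trans (rank_leq_col A)).
by case/rowV0Pn => c /sub_kermxP cA c0; exists c.
Qed.

(** Two words with exponents in {0, 1} and the same product give such a polynomial, as the
    difference of their exponent polynomials. *)
Definition small_coefs (Q : {poly int}) : Prop := forall i, `|Q`_i| <= 1.

(** The leading coefficient is 1 or -1; in this form, multiplying [Q] by it visibly yields a monic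
    polynomial. *)
Lemma lead_coef_small (Q : {poly int}) :
  Q != 0 -> small_coefs Q -> lead_coef Q * lead_coef Q = 1.
Proof.
rewrite -lead_coef_eq0 => Q0 /(_ (size Q).-1); rewrite -/(lead_coef Q).
by case: (lead_coef Q) Q0 => [[|[|n]]|[|n]].
Qed.

Lemma geometric_sum_lt (x : algC) n : 2 < x -> \sum_(i < n) x ^+ i < x ^+ n.
Proof.
move=> x2; elim: n => [|n IHn]; first by rewrite big_ord0 expr0 ltr01.
rewrite big_ord_recr /= exprS.
have x0 : 0 <= x ^+ n by rewrite exprn_ge0 // (le_trans _ (ltW x2)).
rewrite (lt_le_trans (y := 2 * x ^+ n)) //; last by rewrite ler_wpM2r // ltW.
by rewrite mulrDl mul1r ltrD2r.
Qed.

(** If [|z| > 2], the leading term, of modulus [|z| ^ n], outweighs all lower terms together, by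
    [geometric_sum_lt]. *)
Lemma root_small_coefs (Q : {poly int}) (z : algC) :
  Q != 0 -> small_coefs Q -> root (map_poly intr Q) z -> `|z| <= 2.
Proof.
move=> Q0 Qs Qz; rewrite real_leNgt ?normr_real ?realn //.
apply/negP => z2; have := geometric_sum_lt (size Q).-1 z2; apply/negP.
rewrite -real_leNgt ?rpredX ?normr_real ?rpred_sum // => [|i _]; last first.
  by rewrite rpredX ?normr_real.
have /rootP := Qz; rewrite (@horner_coef_wide _ (size Q).-1.+1); last first.
  by rewrite prednK ?size_poly_gt0 // size_poly.
rewrite big_ord_recr /= => /eqP; rewrite addrC addr_eq0 => /eqP.
rewrite coef_map /= -/(lead_coef Q) => /(congr1 Num.norm).
have -> : `|(lead_coef Q)%:~R * z ^+ (size Q).-1| = `|z| ^+ (size Q).-1.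
  rewrite normrM normrX -[RHS]mul1r; congr (_ * _); rewrite -intr_norm.
  have := lead_coef_small Q0 Qs.
  by case: (lead_coef Q) => [[|[|n]]|[|n]] // /eqP; rewrite -?intrM //= ?normr1.
move=> ->; rewrite normrN (le_trans (ler_norm_sum _ _ _)) //.
apply: ler_sum => i _; rewrite normrM normrX coef_map /= -intr_norm.
by rewrite ler_piMl ?exprn_ge0 // (ler_int _ _ 1) Qs.
Qed.

(** Each factor adds a shifted copy and a copy scaled by at most 2, so the bound is multiplied by 1
    + 2. *)
Lemma coef_prod_XsubC_le (s : seq algC) i :
  {in s, forall z, `|z| <= 2} ->
  `|(\prod_(z <- s) ('X - z%:P))`_i| <= 3 ^+ size s.
Proof.
elim: s i => [|z s IHs] i zs.
  by rewrite big_nil coef1; case: (i == _); rewrite ?normr1 ?normr0.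
rewrite big_cons mulrBl coefB coefXM coefCM /= exprS.
have Hs j : `|(\prod_(z <- s) ('X - z%:P))`_j| <= 3 ^+ size s.
  by apply: IHs => y ys; rewrite zs // inE ys orbT.
have -> : 3 * 3 ^+ size s = 3 ^+ size s + 2 * 3 ^+ size s :> algC.
  by rewrite -[X in X + _]mul1r -mulrDl; congr (_ * _); exact: (natrD _ 1 2).
rewrite (le_trans (ler_normB _ _)) // lerD //.
  by case: ifP => _; rewrite ?normr0 ?exprn_ge0 ?ler0n ?Hs.
by rewrite normrM ler_pM // zs ?mem_head.
Qed.

(** The [d.+1] powers of [X^m] reduced modulo [P] live in a space of dimension [d], so they are
    dependent; the dependence is a polynomial [q] that vanishes at [z ^+ m]. *)
Lemma size_minCpoly_exp d (P : {poly rat}) (z : algC) m :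
  P != 0 -> (size P <= d.+1)%N -> root (map_poly ratr P) z ->
  (size (minCpoly (z ^+ m)) <= d.+1)%N.
Proof.
move=> P0 sP Pz.
pose A : 'M[rat]_(d.+1, d) := \matrix_i (\row_(j < d) (('X^m) ^+ i %% P)`_j).
have [c c0 cA] := linear_dependence A (ltnSn d).
pose q : {poly rat} := \sum_(i < d.+1) c 0 i *: 'X^i.
have [/= p [-> pmon pP]] := minCpolyP (z ^+ m).
have q0 : q != 0.
  apply: contra_neq c0 => q0; apply/rowP => i.
  have := congr1 (fun p : {poly rat} => p`_i) q0; rewrite coef0 mxE /q => <-.
  rewrite coef_sum (bigD1 i) //= coefZ coefXn eqxx mulr1 big1 ?addr0 // => j ij.
  by rewrite coefZ coefXn [_ == _ :> nat](eq_sym _ _) (inj_eq val_inj) (negPf ij) mulr0.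
have sq : (size q <= d.+1)%N.
  by rewrite (leq_trans (size_sum _ _ _)) //; apply/bigmax_leqP => i _;
     rewrite (leq_trans (size_scale_leq _ _)) // size_polyXn.
rewrite size_map_poly (leq_trans _ sq) //; apply: dvdp_leq => //.
rewrite -pP; apply/rootP.
have PH (r : {poly rat}) : (map_poly ratr (r %% P)).[z] = (map_poly ratr r).[z] :> algC.
  rewrite [in RHS](divp_eq r P) rmorphD rmorphM hornerD hornerM /=.
  by rewrite (rootP Pz) mulr0 add0r.
have -> : (map_poly ratr q).[z ^+ m] = (map_poly ratr (q \Po 'X^m)).[z] :> algC.
  by rewrite map_comp_poly horner_comp map_polyXn hornerXn.
have -> : q \Po 'X^m = \sum_(i < d.+1) c 0 i *: ('X^m) ^+ i.
  rewrite /q raddf_sum; apply: eq_bigr => i _; rewrite /= linearZ /=.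
  by rewrite comp_Xn_poly.
rewrite -PH; suff -> : (\sum_(i < d.+1) c 0 i *: ('X^m) ^+ i) %% P = 0.
  by rewrite rmorph0 horner0.
rewrite (big_morph (fun p : {poly rat} => p %% P) (modpD P) (mod0p P)).
apply/polyP => j; rewrite coef0 coef_sum.
under eq_bigr => i _ do rewrite modpZl coefZ.
case: (ltnP j d) => jd; last first.
  rewrite big1 // => i _; rewrite nth_default ?mulr0 // (leq_trans _ jd) //.
  by rewrite -ltnS (leq_trans _ sP) // ltn_modp.
have /rowP/(_ (Ordinal jd)) := cA; rewrite !mxE => cAj; rewrite -[RHS]cAj.
by apply: eq_bigr => i _; rewrite !mxE.
Qed.

(* Such a minimal polynomial has integer coefficients bounded by [3 ^ d]. *)
Lemma finite_small_algebraic (d : nat) : exists S : seq algC, forall z : algC,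
  minCpoly z \is a polyOver Num.int -> (size (minCpoly z) <= d.+1)%N ->
  (forall y, root (minCpoly z) y -> `|y| <= 2) -> z \in S.
Proof.
(* Integer coefficients between [- 3 ^ d] and [3 ^ d] are encoded by naturals shifted by [3 ^ d], so
   that the candidate polynomials range over a finite type. *)
pose p (f : {ffun 'I_d.+1 -> 'I_(2 * 3 ^ d).+1}) : {poly algC} :=
  \poly_(i < d.+1) ((f (inord i))%:R - (3 ^ d)%:R).
pose rs f := sval (closed_field_poly_normal (p f)).
exists (flatten [seq rs f | f : {ffun 'I_d.+1 -> 'I_(2 * 3 ^ d).+1}]) => z zint sz zroots.
have cle i : `|(minCpoly z)`_i| <= (3 ^ d)%:R.
  have [r] := closed_field_poly_normal (minCpoly z).
  rewrite (monicP (minCpoly_monic z)) scale1r => def_z.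
  have sr : (size r <= d)%N by move: sz; rewrite def_z size_prod_XsubC.
  rewrite def_z natrX (le_trans (coef_prod_XsubC_le _ _)) //.
    by move=> y yr; apply: zroots; rewrite def_z root_prod_XsubC.
  by rewrite ler_weXn2l // ler1n.
have cZ i : exists2 n : nat, (n < (2 * 3 ^ d).+1)%N &
    (minCpoly z)`_i = n%:R - (3 ^ d)%:R.
  have /polyOverP/(_ i) /intrP[c def_c] := zint.
  have := cle i; rewrite def_c -intr_norm [leRHS]pmulrn ler_int => cB.
  have [n def_n] : exists n : nat, c + (3 ^ d)%:Z = n by exists `|(c + (3 ^ d)%:Z)%R|%N; lia.
  exists n; first by lia.
  by rewrite !pmulrn -def_n intrD addrK.
pose f : {ffun 'I_d.+1 -> 'I_(2 * 3 ^ d).+1} :=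
  [ffun i => inord (s2val (sig2_eqW (cZ (val i))))].
have pE : p f = minCpoly z.
  apply/polyP => i; rewrite coef_poly; case: ltnP => id; last first.
    by rewrite nth_default // (leq_trans sz).
  rewrite ffunE; case: (sig2_eqW _) => n /= nB.
  by rewrite inordK // => ->; rewrite inordK.
apply/flattenP; exists (rs f); first by apply/mapP; exists f => //; rewrite mem_enum.
rewrite /rs; case: closed_field_poly_normal => r /= def_r.
have := root_minCpoly z; rewrite -pE def_r rootZ ?root_prod_XsubC //.
by rewrite lead_coef_eq0 pE minCpoly_eq0.
Qed.

(** Pigeonhole: the first [B] powers of [z] all lie in a finite set [S] that depends only on [d] and
    has fewer than [B] elements, so two of them coincide. *)
Lemma root_of_unity_of_small_powers (d : nat) : exists B : nat,
  forall (P : {poly int}) (z : algC),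
    P != 0 -> (size P <= d.+1)%N -> root (map_poly intr P) z -> z != 0 ->
    (forall m, (0 < m <= B)%N -> exists Q : {poly int},
       [/\ Q != 0, small_coefs Q & root (map_poly intr Q) (z ^+ m)]) ->
    exists2 N : nat, (0 < N)%N & z ^+ N = 1.
Proof.
have [S S_small] := finite_small_algebraic d.
exists (size S).+1 => P z P0 sP Pz z0 small_pow.
have powS m : (0 < m <= (size S).+1)%N -> z ^+ m \in S.
  move=> /small_pow[Q [Q0 Qs Qm]].
  (* Up to sign [Q] is monic, so [z ^+ m] is an algebraic integer. *)
  have Q'Z : map_poly intr (lead_coef Q *: Q) \is a @polyOver algC Num.int.
    by apply/polyOverP => i; rewrite coef_map /= intr_int.
  have Q'mon : map_poly intr (lead_coef Q *: Q) \is @monic algC.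
    rewrite monicE lead_coef_map_inj ?rmorph0 //; last exact: intr_inj.
    by rewrite lead_coefZ lead_coef_small.
  have Q'm (y : algC) : root (map_poly intr (lead_coef Q *: Q)) y = root (map_poly intr Q) y :> bool.
    rewrite /root -mul_polyC rmorphM /= map_polyC hornerM hornerC /= mulf_eq0.
    by rewrite intr_eq0 lead_coef_eq0 (negPf Q0).
  apply: S_small.
  - by apply: (root_monic_Aint _ Q'mon) => //; rewrite Q'm.
  - apply: (@size_minCpoly_exp d (map_poly intr P)).
    + by rewrite map_poly_eq0_id0 // intr_eq0 lead_coef_eq0.
    + by rewrite (leq_trans (size_poly _ _)).
    + by rewrite -map_poly_comp (eq_map_poly (g := intr)) // => c; rewrite /= ratr_int.
  (* The minimal polynomial divides [Q], so every conjugate of [z ^+ m] is a root of [Q] and has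
     modulus at most 2. *)
  - move=> y; have [/= p [-> pmon pP]] := minCpolyP (z ^+ m).
    have : p %| map_poly intr Q.
      rewrite -pP -map_poly_comp (eq_map_poly (g := intr)) // => c.
      by rewrite /= ratr_int.
    rewrite -(dvdp_map (@ratr algC)) => /dvdpP[q def_q] py.
    apply: (@root_small_coefs Q) => //.
    have -> : map_poly intr Q = map_poly ratr (map_poly intr Q) :> {poly algC}.
      by rewrite -map_poly_comp; apply: eq_map_poly => c; rewrite /= ratr_int.
    by rewrite def_q rootM py orbT.
have : ~~ uniq [seq z ^+ m | m <- iota 1 (size S).+1].
  apply/negP => uniq_pow; have := @uniq_leq_size _ _ S uniq_pow.
  rewrite size_map size_iota ltnn => powS'; apply/notF/powS' => y /mapP[m]; rewrite mem_iota add1n ltnS => m_le ->; exact: powS.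
case/(uniqPn 0) => i [j [ij]]; rewrite size_map size_iota => jS.
rewrite !(nth_map 0%N) ?size_iota ?(ltn_trans ij) // !nth_iota ?(ltn_trans ij) //.
move=> eq_ij; exists (j - i)%N; first by rewrite subn_gt0.
apply: (mulfI (expf_neq0 (1 + i) z0)).
by rewrite -exprD mulr1 eq_ij; congr (_ ^+ _); lia.
Qed.

(** * Saturated ideals of [Z[X]] *)

Section SaturatedIdeal.
Variable I : {poly int} -> Prop.
Hypothesis I_0 : I 0.
Hypothesis I_sub : forall p q, I p -> I q -> I (p - q).
Hypothesis I_mulX : forall p, I ('X * p) <-> I p.
Hypothesis I_saturated : forall (c : int) p, c != 0 -> I (c *: p) -> I p.

Lemma ideal_mul p q : I p -> I (q * p).
Proof.
have I_opp r : I r -> I (- r) by move=> Ir; rewrite -sub0r; apply: I_sub.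
have I_add r s : I r -> I s -> I (r + s).
  by move=> Ir Is; rewrite -[s]opprK; apply/I_sub/I_opp.
move=> Ip; elim/poly_ind: q => [|q c IHq]; first by rewrite mul0r.
rewrite mulrDl; apply/I_add; first by rewrite mulrAC mulrC; apply/I_mulX.
have I_nat n : I (p *+ n).
  by elim: n => [|n IHn]; [rewrite mulr0n | rewrite mulrS; apply/I_add].
rewrite mul_polyC -[c]intz scaler_int; case: c => n; first exact: I_nat.
by rewrite NegzE mulrNz; apply/I_opp/I_nat.
Qed.

Hypothesis I_proper : ~ I 1.

Lemma minimal_element P : I P -> P != 0 -> exists P' : {poly int},
  [/\ I P', P' != 0 & forall R, I R -> R != 0 -> (size P' <= size R)%N].
Proof.
move=> IP P0; pose a n := `[< exists R, [/\ I R, R != 0 & size R = n] >].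
have ex_a : exists n, a n by exists (size P); apply/asboolP; exists P.
case: (ex_minnP ex_a) => n /asboolP[R [IR R0 <-]] min_n.
by exists R; split=> // R' IR' R'0; apply: min_n; apply/asboolP; exists R'.
Qed.

(** Any root of [P'] works. [P'] is not constant because [I] is saturated and proper;
    pseudo-division by [P'] leaves a remainder in [I], which vanishes by minimality. A root 0 would
    allow dividing [P'] by ['X] inside [I]. *)
Lemma ideal_root P' : I P' -> P' != 0 ->
  (forall R, I R -> R != 0 -> (size P' <= size R)%N) ->
  exists2 z : algC, z != 0 & forall R, I R -> root (map_poly intr R) z.
Proof.
move=> IP' P'0 minP'.
have sP' : size (map_poly intr P' : {poly algC}) != 1%N.
  rewrite size_map_inj_poly //; last exact: intr_inj.
  apply/eqP => /eqP/size_poly1P[c c0 def_P']; apply: I_proper.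
  by apply: (I_saturated c0); rewrite alg_polyC -def_P'.
have [z P'z] := closed_rootP _ sP'.
exists z.
  apply: contraTneq P'z => ->; rewrite rootE -[0](rmorph0 intr) horner_map /=.
  rewrite intr_eq0 -rootE; apply/negP => /factor_theorem[q def_P'].
  rewrite subr0 mulrC in def_P'.
  have q0 : q != 0 by apply: contra_neq P'0 => q0; rewrite def_P' q0 mulr0.
  have /minP'/(_ q0) : I q by apply/I_mulX; rewrite -def_P'.
  by rewrite def_P' mulrC size_mulX // ltnn.
move=> R IR; have := Pdiv.WeakIdomain.divp_eq R P'.
have -> : R %% P' = 0.
  apply/eqP; apply: contraT => r0.
  suff /minP'/(_ r0) : I (R %% P') by rewrite leqNgt ltn_modp P'0.
  have -> : R %% P' = lead_coef P' ^+ scalp R P' *: R - R %/ P' * P'.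
    by rewrite Pdiv.WeakIdomain.divp_eq addrAC subrr add0r.
  by apply: I_sub; [rewrite -mul_polyC|]; apply: ideal_mul.
rewrite addr0 => /(congr1 (fun p => (map_poly (intr : int -> algC) p).[z])).
rewrite -mul_polyC !rmorphM /= map_polyC !hornerM (rootP P'z) mulr0 hornerC /=.
move=> /eqP; rewrite mulf_eq0 intr_eq0 expf_eq0 lead_coef_eq0 (negPf P'0) andbF.
by rewrite rootE.
Qed.

(** [E] is the cofactor in [P'] of the gcd of [P'] and [Q], up to a constant. The common root makes
    the gcd nonconstant, so [E] is too short to be in [I], while [Q * E] is a multiple of [P'] up to
    constants. *)
Lemma common_root_annihilator P' (Q : {poly int}) (z : algC) :
  I P' -> P' != 0 -> Q != 0 ->
  (forall R, I R -> R != 0 -> (size P' <= size R)%N) ->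
  root (map_poly intr P') z -> root (map_poly intr Q) z ->
  exists2 E, ~ I E & I (Q * E).
Proof.
move=> IP' P'0 Q0 minP' P'z Qz; pose D := gcdp P' Q.
have D0 : D != 0 by rewrite gcdp_eq0 negb_and P'0.
have sD : (1 < size D)%N.
  rewrite ltn_neqAle size_poly_gt0 D0 andbT eq_sym; apply/negP => co.
  (* If they were coprime, a combination of [P'] and [Q] would be a nonzero constant, yet it
     vanishes at [z]. *)
  have /Bezout_coprimepP[[u v] /= uv] : coprimep P' Q := co.
  have /eqP := eqp_size uv; rewrite size_poly1 => /size_poly1P[c c0 def_c].
  have := congr1 (fun p => (map_poly (intr : int -> algC) p).[z]) def_c.
  rewrite rmorphD !rmorphM /= hornerD !hornerM (rootP P'z) (rootP Qz) !mulr0.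
  by rewrite addr0 map_polyC hornerC /= => /esym/eqP; rewrite intr_eq0 (negPf c0).
have /Pdiv.WeakIdomain.dvdpP[[c E] /= c0 def_E] : D %| P' by exact: dvdp_gcdl.
have /Pdiv.WeakIdomain.dvdpP[[b g] /= b0 def_g] : D %| Q by exact: dvdp_gcdr.
have cP'0 : c *: P' != 0 by rewrite scale_poly_eq0 negb_or c0.
have E0 : E != 0 by apply: contra_neq cP'0; rewrite def_E => ->; rewrite mul0r.
exists E.
  move=> IE; have := minP' _ IE E0; rewrite -(size_scale P' c0) def_E size_mul //.
  by case: (size D) sD => [|[|n]] // _; rewrite !addnS /= leqNgt ltnS leq_addr.
apply: (I_saturated b0); rewrite scalerAl def_g -mulrA [D * E]mulrC -def_E.
by rewrite -mul_polyC; do 2 apply: ideal_mul.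
Qed.

End SaturatedIdeal.

(** The common root [z] of [I] is a root of unity, hence shared by a minimal element of [I] and some
    ['X^N - 1]. In the quotient by [I], the class of [E] is then a nonzero vector fixed by
    ['X^N]. *)
Lemma unity_root_annihilator (d : nat) : exists B : nat,
  forall I : {poly int} -> Prop,
    I 0 -> (forall p q, I p -> I q -> I (p - q)) ->
    (forall p, I ('X * p) <-> I p) ->
    (forall (c : int) p, c != 0 -> I (c *: p) -> I p) -> ~ I 1 ->
    forall P, I P -> P != 0 -> (size P <= d.+1)%N ->
    (forall m, (0 < m <= B)%N -> exists Q : {poly int},
       [/\ Q != 0, small_coefs Q & I (Q \Po 'X^m)]) ->
    exists N E, [/\ (0 < N)%N, ~ I E & I (('X^N - 1) * E)].
Proof.
have [B unityB] := root_of_unity_of_small_powers d.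
exists B => I I_0 I_sub I_mulX I_sat I_proper P IP P0 sP small_pow.
have [P' [IP' P'0 minP']] := minimal_element IP P0.
have [z z0 rootz] := ideal_root I_0 I_sub I_mulX I_sat I_proper IP' P'0 minP'.
have [|N N0 zN] := unityB P z P0 sP (rootz _ IP) z0.
  move=> m /small_pow[Q [Q0 Qs /rootz Qm]]; exists Q; split=> //.
  by move: Qm; rewrite !rootE map_comp_poly horner_comp map_polyXn hornerXn.
have XN0 : ('X^N - 1 : {poly int}) != 0 by rewrite monic_neq0 ?monicXnsubC.
have rootXN : root (map_poly intr ('X^N - 1 : {poly int})) z.
  by rewrite rmorphB rmorph1 /= map_polyXn rootE !hornerE zN subrr.
have [E IE IXE] := common_root_annihilator I_0 I_sub I_mulX I_sat IP' P'0 XN0 minP' (rootz _ IP') rootXN.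
by exists N, E.
Qed.

(** * Recurrences with primitive coefficients *)

Definition additive_closed (V : zmodType) (S : V -> Prop) : Prop :=
  S 0 /\ forall u v, S u -> S v -> S (u - v).

Section AdditiveClosed.
Variables (V : zmodType) (S : V -> Prop).
Hypothesis S_closed : additive_closed S.

Lemma additive_closedN u : S u -> S (- u).
Proof. by case: S_closed => S0 S_sub Su; rewrite -sub0r; apply: S_sub. Qed.

Lemma additive_closedD u v : S u -> S v -> S (u + v).
Proof.
by move=> Su Sv; rewrite -[v]opprK; apply: S_closed.2 => //; apply: additive_closedN.
Qed.

Lemma additive_closedMz u c : S u -> S (u *~ c).
Proof.
move=> Su; have S_nat n : S (u *+ n).
  elim: n => [|n IHn]; first by rewrite mulr0n; apply: S_closed.1.
  by rewrite mulrS; apply: additive_closedD.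
case: c => n; first exact: S_nat.
by rewrite NegzE mulrNz; apply/additive_closedN/S_nat.
Qed.

Lemma additive_closed_sum (J : finType) (A : pred J) (F : J -> V) :
  (forall j, A j -> S (F j)) -> S (\sum_(j | A j) F j).
Proof.
move=> SF; elim/big_rec: _ => [|j v Aj Sv]; first exact: S_closed.1.
by apply: additive_closedD => //; apply: SF.
Qed.

Lemma additive_closed_coprime (q c : int) u :
  coprimez q c -> S (u *~ q) -> S (u *~ c) -> S u.
Proof.
case/coprimezP => -[a b] /= ab1 Sq Sc; rewrite -[u]mulr1z -ab1 mulrzDr.
by apply: additive_closedD; rewrite mulrC mulrzA; apply: additive_closedMz.
Qed.

End AdditiveClosed.

Section PrimitiveRecurrence.
Variables (V : zmodType) (y : int -> V) (P : {poly int}) (n : nat).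
Hypothesis n_gt0 : (0 < n)%N.
Hypothesis size_P : (size P <= n.+1)%N.
Hypothesis P_primitive : zcontents P = 1.
Hypothesis recurrence : forall i : int, \sum_(j < n.+1) y (i + j%:Z) *~ P`_j = 0.

Definition additive_span (v : V) : Prop :=
  forall S : V -> Prop, additive_closed S -> (forall i, S (y i)) -> S v.

Definition window_span (v : V) : Prop :=
  exists c : 'I_n -> int, v = \sum_(k < n) y k%:Z *~ c k.

Definition spanned_mod (N : nat) (v : V) : Prop :=
  exists w z, [/\ window_span w, additive_span z & v = w + z *+ N].

Lemma additive_span_closed : additive_closed additive_span.
Proof.
split=> [S S_closed _|u v Su Sv S S_closed Sy]; first exact: S_closed.1.
by apply: S_closed.2; [apply: Su|apply: Sv].
Qed.

Lemma window_span_closed : additive_closed window_span.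
Proof.
split; first by exists (fun=> 0); rewrite big1.
move=> _ _ [a ->] [b ->]; exists (fun k => a k - b k).
by rewrite -sumrB; apply: eq_bigr => k _; rewrite mulrzBr.
Qed.

Lemma window_span_generator (k : nat) : (k < n)%N -> window_span (y k%:Z).
Proof.
move=> kn; exists (fun i => (i == Ordinal kn)%:Z).
rewrite (bigD1 (Ordinal kn)) //= eqxx mulr1z big1 ?addr0 // => i /negPf ->.
by rewrite mulr0z.
Qed.

Lemma spanned_mod_closed N : additive_closed (spanned_mod N).
Proof.
split.
  exists 0, 0; split; rewrite ?mul0rn ?addr0 //; [exact: window_span_closed.1|].
  exact: additive_span_closed.1.
move=> _ _ [w1 [z1 [W1 Z1 ->]]] [w2 [z2 [W2 Z2 ->]]]; exists (w1 - w2), (z1 - z2).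
split; [exact: window_span_closed.2|exact: additive_span_closed.2|].
by rewrite mulrnBl opprD addrACA.
Qed.

Lemma spanned_mod_mul N z : additive_span z -> spanned_mod N (z *+ N).
Proof.
by move=> Zz; exists 0, z; rewrite add0r; split=> //; apply: window_span_closed.1.
Qed.

Section PrimeModulus.
Variable q : nat.
Hypothesis q_prime : prime q.

Let unit_coef (j : nat) : bool := ~~ (q%:Z %| P`_j)%Z.

Let generator_of_multiple j i :
  unit_coef j -> spanned_mod q (y i *~ P`_j) -> spanned_mod q (y i).
Proof.
move=> qj Sij; apply: (@additive_closed_coprime _ _ (spanned_mod_closed q) q%:Z _ _ _ _ Sij).
  by rewrite coprimezE /= prime_coprime //; move: qj; rewrite /unit_coef dvdzE.
by rewrite -pmulrn; apply: spanned_mod_mul => S _ Sy; apply: Sy.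
Qed.

Let nonunit_term j i : ~~ unit_coef j -> spanned_mod q (y i *~ P`_j).
Proof.
rewrite negbK => /dvdzP[c ->]; rewrite mulrzA -pmulrn; apply: spanned_mod_mul.
by apply: (additive_closedMz additive_span_closed) => S _ Sy; apply: Sy.
Qed.

(* It suffices to have the terms of the relation other than the one being
   solved for; those with coefficient divisible by [q] come for free. *)
Let solve_recurrence (j : nat) i : (j <= n)%N -> unit_coef j ->
  (forall l : nat, (l <= n)%N -> l != j -> unit_coef l -> spanned_mod q (y (i + l%:Z))) ->
  spanned_mod q (y (i + j%:Z)).
Proof.
rewrite -ltnS => jn qj others; apply: (generator_of_multiple qj).
have /eqP := recurrence i; rewrite (bigD1 (Ordinal jn)) //= addr_eq0 => /eqP ->.
apply: (additive_closedN (spanned_mod_closed q)).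
apply: (additive_closed_sum (spanned_mod_closed q)) => l lj.
have [ql|/nonunit_term //] := boolP (unit_coef l).
apply: (additive_closedMz (spanned_mod_closed q)); apply: others => //.
by rewrite -ltnS.
Qed.

Let unit_coef_exists : exists j, unit_coef j.
Proof.
apply: contrapT => no_unit; suff : (q%:Z %| zcontents P)%Z.
  by rewrite P_primitive dvdz1 /= => /eqP q1; have := q_prime; rewrite q1.
rewrite dvdz_contents; apply/polyOverP => j.
by apply: contrapT => /negP qj; apply: no_unit; exists j.
Qed.

Let unit_coef_le j : unit_coef j -> (j <= n)%N.
Proof.
rewrite leqNgt; apply: contra => nj; rewrite nth_default ?dvdz0 //.
exact: leq_trans nj.
Qed.

Let window (i : int) := forall k : nat, (k < n)%N -> spanned_mod q (y (i + k%:Z)).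

Let window_up i : window i -> window (i + 1).
Proof.
move=> Wi k; rewrite leq_eqVlt => /predU1P[kn|kn]; last first.
  have -> : i + 1 + k%:Z = i + k.+1%:Z by lia.
  exact: Wi.
(* Only the last index, with [k.+1 = n], is new. Placing the largest invertible coefficient on it
   puts all other invertible ones on the old window. *)
have [j qj maxj] := ex_maxnP unit_coef_exists unit_coef_le.
have jn := unit_coef_le qj.
have -> : i + 1 + k%:Z = (i + 1 + k%:Z - j%:Z) + j%:Z by rewrite subrK.
apply: solve_recurrence => // l ln lj /maxj; rewrite leq_eqVlt (negPf lj) => /= lj'.
have -> : i + 1 + k%:Z - j%:Z + l%:Z = i + (k.+1 + l - j)%N%:Z by lia.
by apply: Wi; lia.
Qed.

Let window_down i : window i -> window (i - 1).
Proof.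
move=> Wi [|k] kn; last first.
  have -> : i - 1 + k.+1%:Z = i + k%:Z by lia.
  exact/Wi/ltnW.
(* Dually, the smallest invertible coefficient is placed on the new term at the left end. *)
have [j qj minj] := ex_minnP unit_coef_exists.
have jn := unit_coef_le qj.
have -> : i - 1 + 0%:Z = (i - 1 - j%:Z) + j%:Z by rewrite subrK addr0.
apply: solve_recurrence => // l ln lj /minj; rewrite leq_eqVlt eq_sym (negPf lj) => /= lj'.
have -> : i - 1 - j%:Z + l%:Z = i + (l - j).-1%:Z by lia.
by apply: Wi; lia.
Qed.

Lemma spanned_mod_prime z : additive_span z -> spanned_mod q z.
Proof.
apply; first exact: spanned_mod_closed.
suff Wi i : window i by move=> i; have := Wi i 0%N n_gt0; rewrite addr0.
have W0 : window 0.
  move=> k kn; rewrite add0r; exists (y k), 0; split.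
  - exact: window_span_generator.
  - exact: additive_span_closed.1.
  - by rewrite mul0rn addr0.
elim: i => [//|i /window_up|i /window_down]; first by rewrite -PoszD addn1.
by rewrite -opprD -PoszD addn1.
Qed.

End PrimeModulus.

(* Nakayama: modulo each prime [q] some coefficient of [P] is invertible, and
   the extreme invertible ones let the recurrence run in both directions. *)
Lemma spanned_mod_all N z : (0 < N)%N -> additive_span z -> spanned_mod N z.
Proof.
elim/ltn_ind: N z => N IHN z N0 Zz.
have [N1|N1] := leqP N 1.
  have -> : N = 1%N by lia.
  by exists 0, z; rewrite add0r; split=> //; apply: window_span_closed.1.
have q_prime := pdiv_prime N1.
have [w [z' [Ww Zz' ->]]] := spanned_mod_prime q_prime Zz.
have def_N : N = (N %/ pdiv N * pdiv N)%N by rewrite divnK ?pdiv_dvd.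
have [||w' [z'' [Ww' Zz'' ->]]] := IHN (N %/ pdiv N)%N _ z' _ Zz'.
- by rewrite ltn_Pdiv // prime_gt1.
- by rewrite divn_gt0 ?prime_gt0 // dvdn_leq ?pdiv_dvd.
exists (w + w' *+ pdiv N), z''; split=> //.
  apply: (additive_closedD window_span_closed) => //.
  by rewrite pmulrn; apply: (additive_closedMz window_span_closed).
by rewrite mulrnDl addrA -mulrnA -def_N.
Qed.

End PrimitiveRecurrence.

(** * Abelian subgroups as Z-modules *)

Section Subgroups.
Variable K : groupType.
Implicit Types (H S : set K).

(* [generated A] is convertible to [subgroup_span [set` A]]. *)
Definition subgroup_span S : set K := smallest (@is_subgroup K) S.

Lemma subgroup1 H : is_subgroup H -> H 1%g. Proof. by case. Qed.

Lemma subgroupV H x : is_subgroup H -> H x -> H (x^-1)%g.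
Proof. by case=> H1 HF Hx; rewrite -[(x^-1)%g]mul1g; apply: HF. Qed.

Lemma subgroupM H x y : is_subgroup H -> H x -> H y -> H (x * y)%g.
Proof.
by move=> sH Hx Hy; rewrite -[y]invgK; apply: sH.2 => //; apply: subgroupV.
Qed.

Lemma subgroupX H x n : is_subgroup H -> H x -> H (x ^+ n)%g.
Proof.
move=> sH Hx; elim: n => [|n IHn]; first exact: subgroup1.
by rewrite expgS; apply: subgroupM.
Qed.

Lemma subgroup_prod H n (F : 'I_n -> K) :
  is_subgroup H -> (forall i, H (F i)) -> H (\prod_i F i)%g.
Proof.
move=> sH HF; elim/big_rec: _ => [|i x _ Hx]; first exact: subgroup1.
exact: subgroupM.
Qed.

Lemma subgroup_span_subgroup S : is_subgroup (subgroup_span S).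
Proof.
split=> [H [[]]//|x y Sx Sy H [sH SH]].
by apply: sH.2; [apply: Sx|apply: Sy].
Qed.

Lemma sub_subgroup_span S : S `<=` subgroup_span S.
Proof. exact: sub_smallest. Qed.

Lemma subgroup_span_min S H : is_subgroup H -> S `<=` H -> subgroup_span S `<=` H.
Proof. exact: smallest_sub. Qed.

Lemma subgroup_span_mono S1 S2 : S1 `<=` S2 -> subgroup_span S1 `<=` subgroup_span S2.
Proof.
move=> S12; apply: subgroup_span_min; first exact: subgroup_span_subgroup.
exact: (subset_trans S12 (@sub_subgroup_span _)).
Qed.

Lemma is_subgroup_commute g : is_subgroup [set h : K | commute g h].
Proof.
split; first exact: commute1.
by move=> x y gx gy; apply: commuteM => //; apply: commuteV.
Qed.

Lemma commute_subgroup_span S g : (forall h, S h -> commute g h) ->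
  forall h, subgroup_span S h -> commute g h.
Proof. by move=> Sg; apply: (subgroup_span_min (is_subgroup_commute g)). Qed.

Lemma subgroup_span_commutative S : (forall g h, S g -> S h -> commute g h) ->
  forall g h, subgroup_span S g -> subgroup_span S h -> commute g h.
Proof.
move=> Sc g h Sg; apply: commute_subgroup_span => {}h Sh.
by apply/commute_sym; move: g Sg; apply: commute_subgroup_span => g; apply: Sc.
Qed.

Definition zpow (g : K) (c : int) : K :=
  match c with Posz n => (g ^+ n)%g | Negz n => (g ^- n.+1)%g end.

Lemma zpow0 g : zpow g 0 = 1%g. Proof. by []. Qed.

Lemma subgroup_zpow H g c : is_subgroup H -> H g -> H (zpow g c).
Proof.
move=> sH Hg; case: c => n; first exact: subgroupX.
by apply: subgroupV => //; apply: subgroupX.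
Qed.

Lemma zpow_absz H g c : is_subgroup H -> H (zpow g c) -> H (g ^+ `|c|)%g.
Proof. by move=> sH; case: c => n //= /(subgroupV sH); rewrite invgK. Qed.

End Subgroups.

(** Bundled with its commutativity so that [ab_type] can carry an additive group structure, in which
    products of powers in [K] become integer linear combinations. *)
Record abelian_subgroup (K : groupType) := AbelianSubgroup {
  ab_set : set K;
  ab_subgroup : is_subgroup ab_set;
  ab_commute : forall g h, ab_set g -> ab_set h -> commute g h
}.

Definition ab_type (K : groupType) (H : abelian_subgroup K) : Type :=
  {x : K | `[< ab_set H x >]}.

Section AbelianSubgroup.
Variables (K : groupType) (H : abelian_subgroup K).

Definition ab_mk (x : K) (Hx : ab_set H x) : ab_type H := exist _ x (asboolT Hx).
Definition ab_val (u : ab_type H) : K := sval u.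

Lemma ab_valP u : ab_set H (ab_val u). Proof. by case: u => x /= /asboolP. Qed.

Lemma ab_val_inj : injective ab_val. Proof. exact: val_inj. Qed.

Definition ab_zero : ab_type H := ab_mk (subgroup1 (ab_subgroup H)).
Definition ab_opp (u : ab_type H) : ab_type H :=
  ab_mk (subgroupV (ab_subgroup H) (ab_valP u)).
Definition ab_add (u v : ab_type H) : ab_type H :=
  ab_mk (subgroupM (ab_subgroup H) (ab_valP u) (ab_valP v)).

Lemma ab_addA : associative ab_add.
Proof. by move=> u v w; apply: ab_val_inj; apply: mulgA. Qed.
Lemma ab_addC : commutative ab_add.
Proof. by move=> u v; apply: ab_val_inj; apply: (@ab_commute _ H); exact: ab_valP. Qed.
Lemma ab_add0 : left_id ab_zero ab_add.
Proof. by move=> u; apply: ab_val_inj; apply: mul1g. Qed.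
Lemma ab_addN : left_inverse ab_zero ab_opp ab_add.
Proof. by move=> u; apply: ab_val_inj; apply: mulVg. Qed.

HB.instance Definition _ := Choice.copy (ab_type H) {x : K | `[< ab_set H x >]}.
HB.instance Definition _ :=
  GRing.isZmodule.Build (ab_type H) ab_addA ab_addC ab_add0 ab_addN.

Lemma ab_val0 : ab_val 0 = 1%g. Proof. by []. Qed.
Lemma ab_valD : {morph ab_val : u v / u + v >-> (u * v)%g}. Proof. by []. Qed.
Lemma ab_valN : {morph ab_val : u / - u >-> (u^-1)%g}. Proof. by []. Qed.

Lemma ab_valMn u n : ab_val (u *+ n) = (ab_val u ^+ n)%g.
Proof. by elim: n => // n IHn; rewrite mulrS ab_valD IHn expgS. Qed.

Lemma ab_valMz u c : ab_val (u *~ c) = zpow (ab_val u) c.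
Proof. by case: c => n; rewrite ?NegzE ?mulrNz -?pmulrn ?ab_valN ab_valMn. Qed.

Lemma ab_val_sum n (F : 'I_n -> ab_type H) :
  ab_val (\sum_i F i) = (\prod_i ab_val (F i))%g.
Proof. exact: (big_morph ab_val ab_valD ab_val0). Qed.

Lemma ab_torsion_free (n : nat) (u : ab_type H) :
  torsion_free K -> (0 < n)%N -> u *+ n = 0 -> u = 0.
Proof.
move=> K_tf n0 un0; apply: ab_val_inj; apply: (K_tf _ n n0).
by rewrite -ab_valMn un0.
Qed.

Lemma ab_torsion_freez (c : int) (u : ab_type H) :
  torsion_free K -> c != 0 -> u *~ c = 0 -> u = 0.
Proof.
move=> K_tf c0 uc0; apply: (@ab_torsion_free `|c|%N) => //; first by rewrite absz_gt0.
by case: c {c0} uc0 => n //=; rewrite NegzE mulrNz => /eqP; rewrite oppr_eq0 => /eqP.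
Qed.

End AbelianSubgroup.

(** * Orbits of an automorphism *)

Section AutomorphismOrbit.
Variables (K : groupType) (beta : automorphism K) (x : K).

Local Notation bpow := (aut_pow beta).
Local Notation X i := (bpow i x).

Lemma aut_powV i g : bpow i (g^-1)%g = (bpow i g)^-1%g.
Proof. by apply: (@mulgI _ (bpow i g)); rewrite -aut_powM !mulgV aut_pow1. Qed.

Lemma aut_powX i g n : bpow i (g ^+ n)%g = (bpow i g ^+ n)%g.
Proof.
by elim: n => [|n IHn]; rewrite ?aut_pow1 // !expgS aut_powM IHn.
Qed.

Lemma aut_pow_zpow i g c : bpow i (zpow g c) = zpow (bpow i g) c.
Proof. by case: c => n; rewrite /zpow ?aut_powV aut_powX. Qed.

Lemma aut_pow_prod i n (F : 'I_n -> K) : bpow i (\prod_j F j)%g = (\prod_j bpow i (F j))%g.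
Proof. exact: (big_morph (bpow i) (@aut_powM _ beta i) (aut_pow1 beta i)). Qed.

Lemma aut_powK i : cancel (bpow i) (bpow (- i)).
Proof. by move=> g; rewrite -aut_powD addNr. Qed.

Lemma aut_pow_inj i : injective (bpow i).
Proof. exact: can_inj (aut_powK i). Qed.

Lemma is_subgroup_preimage i (H : set K) : is_subgroup H -> is_subgroup [set g | H (bpow i g)].
Proof.
move=> sH; split=> [|g h /= Hg Hh]; first by rewrite /= aut_pow1; apply: subgroup1.
by rewrite aut_powM aut_powV; apply: sH.2.
Qed.

Lemma aut_pow_commute i g h : commute g h -> commute (bpow i g) (bpow i h).
Proof. by move=> gh; rewrite /commute -!aut_powM gh. Qed.

Lemma orbit_commute k i j : commute (X i) (X j) -> commute (X (k + i)) (X (k + j)).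
Proof. by rewrite !aut_powD => /(aut_pow_commute k). Qed.

Definition orbit_relation (P : {poly int}) (n : nat) : Prop :=
  (\prod_(j < n) zpow (X j%:Z) P`_j)%g = 1%g.

Lemma orbit_relation_shift (P : {poly int}) n i : orbit_relation P n ->
  (\prod_(j < n) zpow (X (i + j%:Z)) P`_j)%g = 1%g.
Proof.
move=> /(congr1 (bpow i)); rewrite aut_pow1 aut_pow_prod => {2}<-.
by apply: eq_bigr => j _; rewrite aut_pow_zpow aut_powD.
Qed.

(** A factor ['X] of [P] is removed by applying the inverse of [beta] to the relation; the content
    is unchanged because ['X] is monic. *)
Lemma orbit_relation_divX (P : {poly int}) n : (size P <= n.+1)%N -> P != 0 ->
  orbit_relation P n.+1 -> exists P' : {poly int}, [/\ P'`_0 != 0, (size P' <= n.+1)%N,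
    zcontents P' = zcontents P & orbit_relation P' n.+1].
Proof.
have [k] := ubnP (size P); elim: k P => // k IHk P kP sP P0 relP.
have [P00|P00] := eqVneq P`_0 0; last by exists P.
have rootP0 : root P 0 by rewrite rootE horner_coef0 P00.
have /factor_theorem[Q] := rootP0; rewrite subr0 => def_P.
have Q0 : Q != 0 by apply: contra_neq P0; rewrite def_P => ->; rewrite mul0r.
have sPQ : size P = (size Q).+1 by rewrite def_P size_mulX.
have relQ : orbit_relation Q n.+1.
  (* [Q] is shorter than [P] by one, so the last factor of the product for [Q] is trivial. *)
  have Qn : Q`_n = 0 by rewrite nth_default // -ltnS -sPQ.
  rewrite /orbit_relation big_ord_recr /= Qn zpow0 mulg1.
  have := orbit_relation_shift (-1) relP.
  rewrite big_ord_recl /= P00 zpow0 mul1g => {2}<-.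
  apply: eq_bigr => j _; rewrite /bump leq0n add1n def_P coefMX /=.
  by rewrite subn1.
have [||//||P' [P'0 sP' cP' relP']] := IHk Q; rewrite ?(leq_trans _ sP) ?sPQ //.
  by rewrite -ltnS -sPQ.
exists P'; split=> //; rewrite cP' def_P zcontentsM [Z in _ * Z]zcontents_monic ?mulr1 //.
exact: monicX.
Qed.

Definition forward_window (n : nat) : set K :=
  subgroup_span [set g | exists2 k : nat, (k < n)%N & g = X k%:Z].

Lemma forward_windowX n (k : nat) : (k < n)%N -> forward_window n (X k%:Z).
Proof. by move=> kn; apply: sub_subgroup_span; exists k. Qed.

Lemma forward_window_mono m n : (m <= n)%N -> forward_window m `<=` forward_window n.
Proof.
move=> mn; apply: subgroup_span_mono => _ [k km ->]; exists k => //.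
exact: leq_trans mn.
Qed.

(* When [beta] is conjugation by [s], this is the factor in [K] of the word
   [x^{e_0} s^m x^{e_1} s^m ...], where [w = [:: e_0; e_1; ...]]. *)
Fixpoint word_product (m : nat) (w : seq bool) : K :=
  if w is b :: w' then (x ^+ b * bpow m%:Z (word_product m w'))%g else 1%g.

Lemma word_product_rcons w b :
  word_product 1 (rcons w b) = (word_product 1 w * X (size w)%:Z ^+ b)%g.
Proof.
elim: w => [|c w IHw]; first by rewrite /= mul1g -[beta 1%g]/(bpow 1 1%g) aut_pow1 mulg1.
rewrite [rcons _ _]/= /= -[RHS]mulgA; congr (_ * _)%g.
rewrite -[beta _]/(bpow 1 _) IHw aut_powM aut_powX -aut_powD.
by rewrite -PoszD add1n.
Qed.

Lemma word_product_window w : forward_window (size w) (word_product 1 w).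
Proof.
have sW n : is_subgroup (forward_window n) by apply: subgroup_span_subgroup.
elim/last_ind: w => [|w b IHw]; first exact: (subgroup1 (sW _)).
rewrite word_product_rcons size_rcons; apply: (subgroupM (sW _)) => //.
  exact: (forward_window_mono (leqnSn _) IHw).
by apply: (subgroupX _ (sW _)); apply: forward_windowX.
Qed.

Lemma collision_last w1 w2 : size w1 = size w2 -> w1 != w2 ->
  word_product 1 w1 = word_product 1 w2 ->
  exists T : nat, forward_window T (X T%:Z).
Proof.
elim/last_ind: w1 w2 => [|w1 b1 IHw] w2; first by case: w2.
case/lastP: w2 => [|w2 b2]; rewrite !size_rcons // => -[sz] neq.
rewrite !word_product_rcons sz.
have sW n : is_subgroup (forward_window n) by apply: subgroup_span_subgroup.
have W1 := @word_product_window w1; have W2 := @word_product_window w2.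
rewrite sz in W1.
have [eqb|neqb] := eqVneq b1 b2.
  rewrite eqb => /mulIg; apply: IHw => //.
  by apply: contra neq => /eqP ->; rewrite eqb.
move=> eqp; exists (size w2).
case: b1 b2 neqb eqp {neq} => [] [] // _; rewrite !expgb ?mulg1 => eqp.
  by rewrite -[bpow _ x](mulKg (word_product 1 w1)) eqp; apply: (subgroupM (sW _)) => //; apply: (subgroupV (sW _)).
by rewrite -[bpow _ x](mulKg (word_product 1 w2)) -eqp; apply: (subgroupM (sW _)) => //; apply: (subgroupV (sW _)).
Qed.

(** Symmetrically, cancelling the common leading letters leaves an equation [x * beta u = beta v] up
    to exchange of the words; applying the inverse of [beta] gives [X (-1)]. *)
Lemma collision_head w1 w2 : size w1 = size w2 -> w1 != w2 ->
  word_product 1 w1 = word_product 1 w2 ->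
  exists T : nat, forward_window T (X (-1)).
Proof.
elim: w1 w2 => [|b1 w1 IHw] [|b2 w2] //= [sz] neq.
have sW n : is_subgroup (forward_window n) by apply: subgroup_span_subgroup.
have W1 := @word_product_window w1; have W2 := @word_product_window w2.
rewrite sz in W1.
have [eqb|neqb] := eqVneq b1 b2.
  rewrite eqb => /mulgI/(@aut_pow_inj 1); apply: IHw => //.
  by apply: contra neq => /eqP ->; rewrite eqb.
have cancel_head u v : (x * beta u)%g = beta v -> X (-1) = (v * u^-1)%g.
  move=> eqp; apply: (@aut_pow_inj 1).
  by rewrite -aut_powD subrr aut_powM aut_powV -[bpow 1 v]eqp mulgK.
move=> eqp; exists (size w2); rewrite -[autV _ _]/(X (-1)).
case: b1 b2 neqb eqp {neq} => [] [] // _; rewrite !expgb ?mul1g => eqp; first rewrite (cancel_head _ _ eqp).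
  by apply: (subgroupM (sW _)) => //; apply: (subgroupV (sW _)).
rewrite (cancel_head _ _ (esym eqp)).
by apply: (subgroupM (sW _)) => //; apply: (subgroupV (sW _)).
Qed.

(** The two previous lemmas make a long enough window stable under [beta] and under its inverse. *)
Lemma orbit_finitely_generated w1 w2 : size w1 = size w2 -> w1 != w2 ->
  word_product 1 w1 = word_product 1 w2 ->
  exists T : nat, forall i, forward_window T (X i).
Proof.
move=> sz neq eqp.
have [T1 W1] := collision_last sz neq eqp.
have [T2 W2] := collision_head sz neq eqp.
(* The successor makes [T] positive, so that [x] itself belongs to the window. *)
pose T := maxn T1 T2.+1; exists T.
have sW n : is_subgroup (forward_window n) by apply: subgroup_span_subgroup.
have stable i : (forall k : nat, (k < T)%N -> forward_window T (X (i + k%:Z))) ->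
    forall g, forward_window T g -> forward_window T (bpow i g).
  move=> Wi; apply: (subgroup_span_min (is_subgroup_preimage _ (sW T))) => _ [k kT ->].
  change (forward_window T (bpow i (X k%:Z))).
  by rewrite -aut_powD; apply: Wi.
have up : forall g, forward_window T g -> forward_window T (bpow 1 g).
  apply: stable => k; rewrite -PoszD add1n leq_eqVlt => /predU1P[->|]; last first.
    exact: forward_windowX.
  have -> : T%:Z = (T - T1)%N%:Z + T1%:Z by rewrite -PoszD subnK // leq_maxl.
  rewrite aut_powD.
  have : is_subgroup [set g | forward_window T (bpow (T - T1)%N%:Z g)].
    exact: is_subgroup_preimage.
  move/subgroup_span_min; apply; last exact: W1.
  move=> _ [k' k'T1 ->].
  change (forward_window T (bpow (T - T1)%N%:Z (X k'%:Z))); rewrite -aut_powD -PoszD; apply: forward_windowX.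
  by have := leq_maxl T1 T2.+1; rewrite -/T; lia.
have down : forall g, forward_window T g -> forward_window T (bpow (-1) g).
  apply: stable => -[_|k kT]; last first.
    have -> : -1 + k.+1%:Z = k%:Z by lia.
    by apply: forward_windowX; apply: ltnW.
  rewrite addr0; apply: forward_window_mono W2.
  by rewrite ltnW // leq_maxr.
move=> i; elim: i => [|i IHi|i IHi].
- by apply: forward_windowX; rewrite leq_max orbT.
- by rewrite -addn1 PoszD addrC aut_powD; apply: up.
- by rewrite -addn1 PoszD opprD addrC aut_powD; apply: down.
Qed.

End AutomorphismOrbit.

(** * Commutativity of the orbit *)

Section OrbitCommutes.
Variables (K : groupType) (beta : automorphism K) (x : K).
Variables (d : nat) (P : {poly int}).
Hypothesis K_tf : torsion_free K.
Hypothesis d_gt0 : (0 < d)%N.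
Hypothesis size_P : (size P <= d.+1)%N.
Hypothesis P_primitive : zcontents P = 1.
Hypothesis P_const : P`_0 != 0.

Local Notation bpow := (aut_pow beta).
Local Notation X i := (bpow i x).
Local Notation a := (absz P`_0).
Local Notation W := (forward_window beta x d).

Hypothesis window_commute :
  forall i j : nat, (i <= d)%N -> (j <= d)%N -> commute (X i%:Z) (X j%:Z).
Hypothesis P_relation : orbit_relation beta x P d.+1.

Let W_subgroup : is_subgroup W.
Proof. exact: subgroup_span_subgroup. Qed.

Let W_commute g h : W g -> W h -> commute g h.
Proof.
by apply: subgroup_span_commutative => _ _ [i id ->] [j jd ->]; apply: window_commute; exact: ltnW.
Qed.

(* The relation, solved for its first term, puts a power of [x_0] in
   [<x_1, ..., x_d>]; iterating this makes a power of [x_0] commute with any [x_i]. *)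
Let window_power_step g : W g -> W (bpow (-1) (g ^+ a)%g).
Proof.
pose S := [set h : K | W h /\ W (bpow (-1) (h ^+ a)%g)].
have subS : is_subgroup S.
  split; first by split; rewrite ?expg1n ?aut_pow1; apply: subgroup1.
  move=> h1 h2 [W1 W1'] [W2 W2']; split; first exact: W_subgroup.2.
  rewrite expgnFl; last exact: W_commute.
  by rewrite aut_powM aut_powV; apply: W_subgroup.2.
move=> Wg; suff [] : S g by [].
move: g Wg; apply: (subgroup_span_min subS) => _ [k kd ->]; split.
  exact: forward_windowX.
rewrite aut_powX -aut_powD; case: k kd => [|k] kd; last first.
  have -> : -1 + k.+1%:Z = k%:Z by lia.
  by apply: (subgroupX _ W_subgroup); apply: forward_windowX; apply: ltnW.
apply: (zpow_absz W_subgroup).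
have := orbit_relation_shift (-1) P_relation.
rewrite big_ord_recl [val _]/= => /(canRL (mulgK _)); rewrite mul1g => ->.
apply: (subgroupV W_subgroup); apply: (subgroup_prod W_subgroup) => j.
apply: (subgroup_zpow _ W_subgroup).
have -> : -1 + (lift ord0 j)%:Z = j%:Z by rewrite lift0; lia.
exact: forward_windowX.
Qed.

Let window_power (i : nat) : exists2 M : nat, (0 < M)%N & W (bpow (- i%:Z) (x ^+ M)%g).
Proof.
elim: i => [|i [M M0 WM]].
  by exists 1%N; rewrite // oppr0 expg1; apply: (@forward_windowX _ beta x d 0).
exists (M * a)%N; first by rewrite muln_gt0 M0 absz_gt0.
have -> : - i.+1%:Z = -1 + - i%:Z by lia.
by rewrite aut_powD expgnA aut_powX; apply: window_power_step.
Qed.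

Let power_commute (i : nat) : exists2 M : nat, (0 < M)%N & commute (x ^+ M)%g (X i%:Z).
Proof.
have [M M0 WM] := window_power i; exists M => //.
rewrite -[(x ^+ M)%g](aut_powK beta (- i%:Z)) opprK; apply: aut_pow_commute.
by apply: W_commute WM _; apply: (@forward_windowX _ beta x d 0).
Qed.

Variable T : nat.
Hypothesis orbit_window : forall i, forward_window beta x T (X i).

(** The exponent from [power_commute] depends on the index, but the orbit lies in the span of [T] of
    its elements, so a product of [T] exponents serves for all. *)
Let central_power : exists2 M : nat, (0 < M)%N & forall i, commute (x ^+ M)%g (X i).
Proof.
have [M M0 cM] : exists2 M : nat, (0 < M)%N &
    forall k : nat, (k < T)%N -> commute (x ^+ M)%g (X k%:Z).
  elim: (T) => [|n [M M0 cM]]; first by exists 1%N.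
  have [M' M'0 cM'] := power_commute n; exists (M * M')%N; first by rewrite muln_gt0 M0.
  move=> k; rewrite ltnS leq_eqVlt => /predU1P[->|/cM ck]; apply/commute_sym.
    by rewrite mulnC expgnA; apply/commuteX/commute_sym.
  by rewrite expgnA; apply/commuteX/commute_sym.
exists M => // i; move: (bpow i x) (orbit_window i).
by apply: commute_subgroup_span => _ [k kT ->]; apply: cM.
Qed.

Let L := subgroup_span [set g | exists i, g = X i].
(** The centre of [L]: commuting with the generators suffices. *)
Let C := [set g | L g /\ forall j, commute g (X j)].

Let L_subgroup : is_subgroup L. Proof. exact: subgroup_span_subgroup. Qed.

Let L_orbit i : L (X i). Proof. by apply: sub_subgroup_span; exists i. Qed.

Let C_subgroup : is_subgroup C.
Proof.
split; first by split=> [|j]; [exact: (subgroup1 L_subgroup)|apply/commute_sym/commute1].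
move=> g h [Lg cg] [Lh ch]; split=> [|j]; first exact: L_subgroup.2.
by apply/commute_sym/commuteM; [|apply/commuteV]; apply/commute_sym.
Qed.

Let C_commute g h : C g -> L h -> commute g h.
Proof. by case=> _ cg; apply: commute_subgroup_span => _ [j ->]. Qed.

Let C_shift g : C g -> C (bpow 1 g).
Proof.
case=> Lg cg; split; last first.
  by move=> j; have := aut_pow_commute beta 1 (cg (j - 1)); rewrite -aut_powD subrKC.
move: g Lg {cg}; apply: (subgroup_span_min (is_subgroup_preimage _ _ L_subgroup)) => _ [i ->].
by change (L (bpow 1 (X i))); rewrite -aut_powD.
Qed.

Let extended_window n := [set g | (exists2 k : nat, (k < n)%N & g = X k%:Z) \/ C g].

Let extended_window_commute n g h : (n <= d.+1)%N ->
  subgroup_span (extended_window n) g -> subgroup_span (extended_window n) h -> commute g h.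
Proof.
move=> nd; apply: subgroup_span_commutative => {}g {}h.
case=> [[i id ->]|Cg] [[j jd ->]|Ch].
- by apply: window_commute; rewrite -ltnS; exact: leq_trans nd.
- by apply/commute_sym/C_commute.
- exact: C_commute.
- by apply: C_commute => //; case: Ch.
Qed.

(* Nakayama applies to the [M]-th powers, which are central; as [K] is torsion-free
   the resulting identity can be divided by [M]. *)
Let next_in_window : subgroup_span (extended_window d) (X d%:Z).
Proof.
have [M M0 xMC] := central_power.
have C_pow i : C (X i ^+ M)%g.
  rewrite -aut_powX; split=> [|j]; first by rewrite aut_powX; apply: (subgroupX _ L_subgroup).
  by rewrite -[j](subrKC i) aut_powD; apply: aut_pow_commute.
(* With [d.+1] indices, [X d] and the whole relation live in one additive group, together with the
   central powers [y i]. *)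
pose E := AbelianSubgroup (subgroup_span_subgroup (extended_window d.+1))
  (fun g h => @extended_window_commute d.+1 g h (leqnn _)).
have EC g : C g -> ab_set E g by move=> Cg; apply: sub_subgroup_span; right.
have EX (k : nat) : (k < d.+1)%N -> ab_set E (X k%:Z).
  by move=> kd; apply: sub_subgroup_span; left; exists k.
pose y i : ab_type E := ab_mk (EC _ (C_pow i)).
pose z (k : 'I_d.+1) : ab_type E := ab_mk (EX k (ltn_ord k)).
have yz (k : 'I_d.+1) : y k%:Z = z k *+ M by apply: ab_val_inj; rewrite ab_valMn.
have sum_z : \sum_(j < d.+1) z j *~ P`_j = 0.
  apply: ab_val_inj; rewrite ab_val_sum -[RHS]P_relation.
  by apply: eq_bigr => j _; rewrite ab_valMz.
have recurrence i : \sum_(j < d.+1) y (i + j%:Z) *~ P`_j = 0.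
  have sum_y : \sum_(j < d.+1) y j%:Z *~ P`_j = 0.
    under eq_bigr => j _ do rewrite yz pmulrn -mulrzA mulrC mulrzA -pmulrn.
    by rewrite sumrMnl sum_z mul0rn.
  have := congr1 (fun u => bpow i (ab_val u)) sum_y; rewrite /= aut_pow1 => sum_y1.
  apply: ab_val_inj; rewrite -[RHS]sum_y1 !ab_val_sum aut_pow_prod.
  apply: eq_bigr => j _.
  rewrite !ab_valMz aut_pow_zpow; congr zpow.
  change (X (i + j%:Z) ^+ M = bpow i (X j%:Z ^+ M))%g.
  by rewrite aut_powX -aut_powD.
have [|w [v [[c ->] v_span]]] := spanned_mod_all d_gt0 size_P P_primitive recurrence M0 (z := y d%:Z).
  by move=> S _; apply.
(* The error term is a combination of the central powers [y i], hence central itself. *)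
have Cv : C (ab_val v).
  apply: (v_span (fun u => C (ab_val u))) => [|i]; last exact: C_pow.
  split=> [|u1 u2 C1 C2]; first exact: (subgroup1 C_subgroup).
  by rewrite ab_valD ab_valN; apply: C_subgroup.2.
have zk (k : 'I_d) : y k%:Z = z (widen_ord (leqnSn d) k) *+ M by rewrite -yz.
have := yz ord_max; rewrite [val _]/= => ->.
under eq_bigr => k _ do rewrite zk pmulrn -mulrzA mulrC mulrzA -pmulrn.
rewrite sumrMnl -mulrnDl => /eqP; rewrite -subr_eq0 -mulrnBl => /eqP/(ab_torsion_free K_tf M0).
move=> /eqP; rewrite subr_eq0 => /eqP /(congr1 (@ab_val _ _)) => def_x.
rewrite -[X d%:Z]/(ab_val (z ord_max)) def_x ab_valD ab_val_sum.
have sE : is_subgroup (subgroup_span (extended_window d)) by apply: subgroup_span_subgroup.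
apply: (subgroupM sE); last by apply: sub_subgroup_span; right.
apply: (subgroup_prod sE) => k; rewrite ab_valMz; apply: (subgroup_zpow _ sE).
by apply: sub_subgroup_span; left; exists k.
Qed.

(** By [next_in_window] the commutative group spanned by [x_0, ..., x_{d-1}] and [C] is stable under
    [beta], so it contains the forward orbit; any two indices become nonnegative after a common
    shift. *)
Lemma orbit_commutative i j : commute (X i) (X j).
Proof.
have sE : is_subgroup (subgroup_span (extended_window d)) by apply: subgroup_span_subgroup.
have shift g : subgroup_span (extended_window d) g -> subgroup_span (extended_window d) (bpow 1 g).
  move: g; apply: (subgroup_span_min (is_subgroup_preimage _ _ sE)) => g [[k kd ->]|Cg].
    change (subgroup_span (extended_window d) (bpow 1 (X k%:Z))); rewrite -aut_powD -PoszD add1n.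
    have := kd; rewrite leq_eqVlt => /predU1P[->|kd']; first exact: next_in_window.
    by apply: sub_subgroup_span; left; exists k.+1.
  by apply: sub_subgroup_span; right; apply: C_shift.
have forward (k : nat) : subgroup_span (extended_window d) (X k%:Z).
  elim: k => [|k IHk]; first by apply: sub_subgroup_span; left; exists 0%N.
  by rewrite -add1n PoszD aut_powD; apply: shift.
pose k : int := `|i| + `|j|.
have [m im] : exists m : nat, i = - k + m by exists (absz (k + i)); rewrite /k; lia.
have [n jn] : exists n : nat, j = - k + n by exists (absz (k + j)); rewrite /k; lia.
by rewrite im jn; apply/orbit_commute/(extended_window_commute (leqnSn d)).
Qed.

End OrbitCommutes.

(** * The orbit as a quotient of [Z[X]] *)

Section OrbitEvaluation.
Variables (K : groupType) (beta : automorphism K) (x : K).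
Local Notation bpow := (aut_pow beta).
Local Notation X i := (bpow i x).
Hypothesis X_commute : forall i j, commute (X i) (X j).

Let X_set_commute g h :
  [set g | exists i, g = X i] g -> [set g | exists i, g = X i] h -> commute g h.
Proof. by move=> [i ->] [j ->]; apply: X_commute. Qed.

Definition orbit_group : abelian_subgroup K :=
  AbelianSubgroup (subgroup_span_subgroup [set g | exists i, g = X i])
    (subgroup_span_commutative X_set_commute).

Lemma orbit_groupP i : ab_set orbit_group (X i).
Proof. by apply: sub_subgroup_span; exists i. Qed.

Definition orbit_elt (k : nat) : ab_type orbit_group := ab_mk (orbit_groupP k%:Z).

(** The element [R(beta) x], where ['X] acts as [beta]. Its kernel is the ideal to which the root
    argument applies. *)
Definition orbit_eval (R : {poly int}) : ab_type orbit_group :=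
  \sum_(k < size R) orbit_elt k *~ R`_k.

Lemma orbit_eval_wide n (R : {poly int}) : (size R <= n)%N ->
  orbit_eval R = \sum_(k < n) orbit_elt k *~ R`_k.
Proof.
move=> Rn; rewrite /orbit_eval (big_ord_widen _ (fun k => orbit_elt k *~ R`_k) Rn).
rewrite big_mkcond; apply: eq_bigr => k _; case: ltnP => // Rk.
by rewrite nth_default // mulr0z.
Qed.

Lemma orbit_eval_is_additive : zmod_morphism orbit_eval.
Proof.
move=> R S; pose n := maxn (size R) (size S).
rewrite !(@orbit_eval_wide n) ?leq_maxl ?leq_maxr //; last first.
  by rewrite (leq_trans (size_polyD _ _)) // size_polyN.
by rewrite -sumrB; apply: eq_bigr => k _; rewrite coefB mulrzBr.
Qed.

HB.instance Definition _ :=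
  GRing.isZmodMorphism.Build {poly int} (ab_type orbit_group) orbit_eval orbit_eval_is_additive.

Lemma orbit_evalZ (c : int) R : orbit_eval (c *: R) = orbit_eval R *~ c.
Proof.
rewrite !(@orbit_eval_wide (size R)) ?size_scale_leq //.
by rewrite mulrz_suml; apply: eq_bigr => k _; rewrite coefZ mulrC mulrzA.
Qed.

Lemma orbit_evalXn k : orbit_eval 'X^k = orbit_elt k.
Proof.
rewrite (@orbit_eval_wide k.+1) ?size_polyXn // big_ord_recr /= coefXn eqxx mulr1z.
by rewrite big1 ?add0r // => i _; rewrite coefXn ltn_eqF // mulr0z.
Qed.

Lemma ab_val_orbit_eval (R : {poly int}) n : (size R <= n)%N ->
  ab_val (orbit_eval R) = (\prod_(k < n) zpow (X k%:Z) R`_k)%g.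
Proof.
move=> Rn; rewrite (orbit_eval_wide Rn) ab_val_sum.
by apply: eq_bigr => k _; rewrite ab_valMz.
Qed.

Lemma orbit_evalMX R : ab_val (orbit_eval ('X * R)) = bpow 1 (ab_val (orbit_eval R)).
Proof.
have sXR : (size ('X * R : {poly int})%R <= (size R).+1)%N.
  by rewrite (leq_trans (size_polyMleq _ _)) // size_polyX.
rewrite (ab_val_orbit_eval sXR) (ab_val_orbit_eval (leqnn _)) aut_pow_prod.
rewrite big_ord_recl coefXM eqxx zpow0 mul1g; apply: eq_bigr => k _.
by rewrite lift0 coefXM aut_pow_zpow -aut_powD -PoszD add1n.
Qed.

Lemma orbit_evalMXn N R :
  ab_val (orbit_eval ('X^N * R)) = bpow N%:Z (ab_val (orbit_eval R)).
Proof.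
elim: N => [|N IHN]; first by rewrite expr0 mul1r.
by rewrite exprS -mulrA orbit_evalMX IHN -aut_powD.
Qed.

(** The recursion defining [word_product] is Horner's scheme, with ['X^m] acting as the [m]-th power
    of [beta]. *)
Lemma word_product_eval (m : nat) (w : seq bool) :
  word_product beta x m w =
  ab_val (orbit_eval ((\poly_(k < size w) (nth false w k : nat)%:Z) \Po 'X^m)).
Proof.
elim: w => [|b w IHw]; first by rewrite poly_def big_ord0 comp_poly0 raddf0.
rewrite -[LHS]/(x ^+ b * bpow m%:Z (word_product beta x m w))%g IHw -orbit_evalMXn.
have -> : \poly_(k < size (b :: w)) (nth false (b :: w) k : nat)%:Z =
    'X * \poly_(k < size w) (nth false w k : nat)%:Z + ((b : nat)%:Z)%:P.
  apply/polyP => k; rewrite coefD coefXM coefC !coef_poly.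
  by case: k => [|k] /=; rewrite ?add0r // ltnS addr0.
rewrite comp_polyD comp_polyM comp_polyX comp_polyC addrC raddfD ab_valD; congr (_ * _)%g.
have -> : ((b : nat)%:Z)%:P = (b : nat)%:Z *: 'X^0 :> {poly int} by rewrite expr0 alg_polyC.
by rewrite /= orbit_evalZ orbit_evalXn ab_valMz.
Qed.

Lemma orbit_annihilator_fixed N (R : {poly int}) :
  orbit_eval R <> 0 -> orbit_eval (('X^N - 1) * R) = 0 ->
  exists2 v : K, v != 1%g & bpow N%:Z v = v.
Proof.
move=> R0 NR0; exists (ab_val (orbit_eval R)).
  by apply: contra_not_neq R0 => R1; apply: ab_val_inj; rewrite R1.
move/eqP: NR0; rewrite mulrBl mul1r raddfB subr_eq0 => /eqP eqN.
by rewrite -orbit_evalMXn; congr ab_val.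
Qed.

(** [Q] is the difference of the two 0-1 polynomials of the words, nonzero because these determine
    words of a given length. *)
Lemma collision_annihilator (m : nat) (w1 w2 : seq bool) : (0 < m)%N ->
  size w1 = size w2 -> w1 != w2 ->
  word_product beta x m w1 = word_product beta x m w2 ->
  exists Q : {poly int}, [/\ Q != 0, small_coefs Q & orbit_eval (Q \Po 'X^m) = 0].
Proof.
move=> m0 sz neq; rewrite !word_product_eval sz => /(@ab_val_inj _ _) eqw.
exists (\poly_(k < size w2) (nth false w1 k : nat)%:Z -
        \poly_(k < size w2) (nth false w2 k : nat)%:Z); split.
- apply: contra neq; rewrite subr_eq0 => /eqP eqp; apply/eqP.
  apply: (@eq_from_nth _ false) => // k kw; rewrite sz in kw.
  have := congr1 (fun p : {poly int} => p`_k) eqp; rewrite /= !coef_poly kw.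
  by case: (nth _ w1 k) (nth _ w2 k) => [] [].
- move=> k; rewrite coefB !coef_poly; case: ifP => // _.
  by case: (nth _ w1 k) (nth _ w2 k) => [] [].
- by rewrite comp_polyB raddfB /= eqw subrr.
Qed.

End OrbitEvaluation.

Lemma periodic_element (d : nat) : (0 < d)%N -> exists B : nat,
  forall (K : groupType) (beta : automorphism K) (x : K) (P : {poly int}),
    torsion_free K -> x != 1%g ->
    (size P <= d.+1)%N -> zcontents P = 1 ->
    (forall i j : nat, (i <= d)%N -> (j <= d)%N ->
       commute (aut_pow beta i%:Z x) (aut_pow beta j%:Z x)) ->
    orbit_relation beta x P d.+1 ->
    (forall m, (0 < m <= B)%N -> exists w1 w2 : seq bool,
       [/\ size w1 = size w2, w1 != w2 &
          word_product beta x m w1 = word_product beta x m w2]) ->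
    exists N v, [/\ (0 < N)%N, v != 1%g & aut_pow beta N%:Z v = v].
Proof.
(* The maximum makes a collision for [m = 1] available, from which finite generation and then
   commutativity of the orbit follow. *)
move=> d0; have [B annihilator] := unity_root_annihilator d; exists (maxn 1 B).
move=> K beta x P K_tf x1 sP cP window_comm relP collisions.
have P0 : P != 0 by rewrite -zcontents_eq0 cP.
have [P1 [P10 sP1 cP1 relP1]] := orbit_relation_divX sP P0 relP; rewrite cP in cP1.
have [|w1 [w2 [sz neq eqw]]] := collisions 1%N; first by rewrite leq_maxl.
have [T orbit_T] := orbit_finitely_generated sz neq eqw.
have comm := orbit_commutative K_tf d0 sP1 cP1 P10 window_comm relP1 orbit_T.
(* The annihilator of [x] allows division by ['X] because [beta] is injective, is saturated because
   [K] is torsion-free, and is proper because [x] is nontrivial. *)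
have [||||||||m /andP[m0 mB]|N [E [N0 E0 NE0]]] :=
  annihilator (fun R => orbit_eval comm R = 0) _ _ _ _ _ P.
- exact: raddf0.
- by move=> p q p0 q0; rewrite raddfB /= p0 q0 subr0.
- move=> p; split=> [Xp|p1]; last first.
    by apply: ab_val_inj; rewrite orbit_evalMX p1 aut_pow1.
  apply: ab_val_inj; apply: (@aut_pow_inj _ beta 1).
  by rewrite -orbit_evalMX Xp aut_pow1.
- by move=> c p c0; rewrite orbit_evalZ => /(ab_torsion_freez K_tf c0).
- rewrite -[1](expr0 'X) orbit_evalXn => /(congr1 (@ab_val _ _)) /= xe.
  by case/eqP: x1.
- by apply: ab_val_inj; rewrite (ab_val_orbit_eval comm sP).
- exact: P0.
- exact: sP.
- have [|w [w' [sz' neq' eqw']]] := collisions m; first by rewrite m0 leq_max mB orbT.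
  exact: collision_annihilator eqw'.
by have [v v1 vN] := orbit_annihilator_fixed E0 NE0; exists N, v.
Qed.

(** * Relations in free abelian groups *)

(** More vectors than dimensions are dependent over the rationals; denominators are cleared and the
    content is divided out. *)
Lemma primitive_dependence (d n : nat) (v : 'I_d.+1 -> 'rV[int]_n) : (n <= d)%N ->
  exists P : {poly int}, [/\ (size P <= d.+1)%N, zcontents P = 1 &
    \sum_(j < d.+1) v j *~ P`_j = 0].
Proof.
move=> nd.
have [c c0 cA] := linear_dependence (\matrix_(j < d.+1, i < n) ((v j 0 i)%:~R : rat)) nd.
pose q : {poly rat} := \poly_(j < d.+1) c 0 (inord j).
have [p [a a0 def_q]] := rat_poly_scale q.
have a0' : (a%:~R : rat) != 0 by rewrite intr_eq0.
have cE (j : 'I_d.+1) : (p`_j)%:~R = a%:~R * c 0 j :> rat.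
  have /(congr1 (fun r : {poly rat} => a%:~R * r`_j)) := def_q.
  by rewrite coefZ coef_map mulVKf // coef_poly ltn_ord inord_val.
have p0 : p != 0.
  apply: contra_neq c0 => p0; apply/rowP => j; rewrite mxE.
  by apply: (mulfI a0'); rewrite -cE p0 coef0 mulr0.
exists (zprimitive p); split; rewrite ?zcontents_primitive ?p0 // ?size_zprimitive.
  have -> : size p = size q; last exact: size_poly.
  by rewrite def_q size_scale ?invr_eq0 // size_map_inj_poly //; exact: intr_inj.
have [zc def_zc] : exists zc, p = zc *: zprimitive p /\ zc != 0.
  by exists (zcontents p); rewrite -zpolyEprim zcontents_eq0.
case: def_zc => def_p zc0.
have zc0' : (zc%:~R : rat) != 0 by rewrite intr_eq0.
apply/rowP => i; rewrite summxE mxE.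
apply: (@intr_inj rat); rewrite rmorph_sum rmorph0; apply: (mulfI zc0').
rewrite mulr0 mulr_sumr; have /rowP/(_ i) := cA; rewrite !mxE => cAi.
apply: (mulfI (invr_neq0 a0')); rewrite mulr0 -[RHS]cAi mulr_sumr.
apply: eq_bigr => j _; rewrite mxE -scaler_int intz mxE rmorphM /=.
by rewrite [zc%:~R * _]mulrA -rmorphM /= -coefZ -def_p cE -mulrA mulKf.
Qed.

Section FreeAbelian.
Variables (K : groupType) (n : nat) (f : 'rV[int]_n -> K).
Hypothesis f_morph : {morph f : u v / u + v >-> (u * v)%g}.

Lemma morph_Zn0 : f 0 = 1%g.
Proof. by apply: (@mulgI _ (f 0)); rewrite -f_morph addr0 mulg1. Qed.

Lemma morph_ZnMz v c : f (v *~ c) = zpow (f v) c.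
Proof.
have f_nat m : f (v *+ m) = (f v ^+ m)%g.
  by elim: m => [|m IHm]; rewrite ?morph_Zn0 // mulrS f_morph IHm expgS.
case: c => m; first exact: f_nat.
apply: (@mulgI _ (f (v *+ m.+1))); rewrite -f_morph NegzE mulrNz -pmulrn subrr.
by rewrite morph_Zn0 f_nat /= mulgV.
Qed.

Lemma morph_Zn_sum m (F : 'I_m -> 'rV[int]_n) : f (\sum_i F i) = (\prod_i f (F i))%g.
Proof. exact: (big_morph f f_morph morph_Zn0). Qed.

End FreeAbelian.

Lemma isomorphic_to_Zn_commute (K : groupType) n (H : set K) :
  isomorphic_to_Zn n H -> forall g h, H g -> H h -> commute g h.
Proof.
case=> f [f_morph [_ _ f_surj]] g h /f_surj[u _ <-] /f_surj[v _ <-].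
by rewrite /commute -!f_morph addrC.
Qed.

Lemma isomorphic_to_Zn_relation (K : groupType) (n d : nat) (H : set K) (g : nat -> K) :
  isomorphic_to_Zn n H -> (n <= d)%N -> (forall j, (j <= d)%N -> H (g j)) ->
  exists P : {poly int}, [/\ (size P <= d.+1)%N, zcontents P = 1 &
    (\prod_(j < d.+1) zpow (g j) P`_j)%g = 1%g].
Proof.
case=> f [f_morph [_ _ f_surj]] nd Hg.
have lift_g (j : 'I_d.+1) : exists v, f v = g j.
  by have [|v _ fv] := f_surj (g j); [apply: Hg; rewrite -ltnS|exists v].
have [v fv] := choice lift_g.
have [P [sP cP relP]] := primitive_dependence v nd; exists P; split=> //.
rewrite -[RHS](morph_Zn0 f_morph) -relP (morph_Zn_sum f_morph).
by apply: eq_bigr => j _; rewrite (morph_ZnMz f_morph) fv.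
Qed.

(** * Growth *)

Section Balls.
Variables (G : groupType) (A : {fset G}).

Lemma ball1 n : ball A n 1%g.
Proof. by exists [::]; rewrite big_nil. Qed.

Lemma ball_mono m n : (m <= n)%N -> ball A m `<=` ball A n.
Proof. by move=> mn g [w [wm wA ->]]; exists w; split=> //; apply: leq_trans mn. Qed.

Lemma ballM m n g h : ball A m g -> ball A n h -> ball A (m + n) (g * h)%g.
Proof.
move=> [v [vm vA ->]] [w [wn wA ->]]; exists (v ++ w); split.
- by rewrite size_cat leq_add.
- by move=> x; rewrite mem_cat => /orP[/vA|/wA].
- by rewrite big_cat.
Qed.

Lemma ballV n g : ball A n g -> ball A n (g^-1)%g.
Proof.
move=> [w [wn wA ->]]; exists [seq (x^-1)%g | x <- rev w]; split.
- by rewrite size_map size_rev.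
- move=> _ /mapP[x xw ->]; rewrite invgK; rewrite mem_rev in xw.
  by case: (wA x xw); [right|left].
- by rewrite big_map prodgV revK.
Qed.

Lemma ball_generator g : g \in A -> ball A 1 g.
Proof.
move=> gA; exists [:: g]; split=> //; last by rewrite big_seq1.
by move=> x; rewrite inE => /eqP ->; left.
Qed.

Lemma ballX m n g : ball A m g -> ball A (m * n) (g ^+ n)%g.
Proof.
move=> Bg; elim: n => [|n IHn]; first exact: ball1.
by rewrite mulnS expgS; apply: ballM.
Qed.

Lemma ball_split m n g : ball A (m + n) g ->
  exists h k, [/\ ball A m h, ball A n k & g = (h * k)%g].
Proof.
move=> [w [wmn wA ->]].
exists (\prod_(x <- take m w) x)%g, (\prod_(x <- drop m w) x)%g; split.
- exists (take m w); split=> // [|x /mem_take /wA //].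
  by rewrite size_take; case: ltnP.
- exists (drop m w); split=> // [|x /mem_drop /wA //].
  by rewrite size_drop leq_subLR.
- by rewrite -big_cat cat_take_drop.
Qed.

Lemma mem_ball n g : (g \in fset_set (ball A n)) = (g \in ball A n).
Proof. by rewrite in_fset_set //; apply: ball_finite. Qed.

Lemma growth_function_ge (s : seq G) n :
  uniq s -> (forall g, g \in s -> ball A n g) -> (size s <= growth_function A n)%N.
Proof.
move=> s_uniq sB; apply: uniq_leq_size => // g /sB Bg.
by have := mem_ball n g; rewrite mem_set // => ->.
Qed.

Lemma growth_function_gt0 n : (0 < growth_function A n)%N.
Proof.
apply: (@growth_function_ge [:: 1%g]) => // g; rewrite inE => /eqP ->; exact: ball1.
Qed.

Lemma growth_function_mono m n : (m <= n)%N -> (growth_function A m <= growth_function A n)%N.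
Proof.
move=> mn; apply: growth_function_ge => [|g]; first exact: fset_uniq.
by have -> := mem_ball m g => /set_mem; apply: ball_mono.
Qed.

Lemma growth_functionM m n :
  (growth_function A (m + n) <= growth_function A m * growth_function A n)%N.
Proof.
rewrite -(size_allpairs (fun g h => (g * h)%g)); apply: uniq_leq_size => [|g].
  exact: fset_uniq.
have -> := mem_ball (m + n) g => /set_mem/ball_split[h [k [Bh Bk ->]]].
apply: allpairs_f; first by have -> := mem_ball m h; apply: mem_set.
by have -> := mem_ball n k; apply: mem_set.
Qed.

Lemma growth_functionX m n :
  (growth_function A (m * n) <= growth_function A m ^ n)%N.
Proof.
elim: n => [|n IHn]; last first.
  by rewrite mulnS expnS (leq_trans (growth_functionM _ _)) // leq_mul2l IHn orbT.
rewrite muln0 expn0; have : {subset fset_set (ball A 0) <= [:: 1%g]}.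
  move=> g; have -> := mem_ball 0 g => /set_mem[w [w0 _ ->]].
  by move: w0; rewrite leqn0 size_eq0 => /eqP ->; rewrite big_nil mem_head.
by apply: uniq_leq_size; apply: fset_uniq.
Qed.

Section Fekete.
Variable R : realType.
Local Notation gamma n := ((growth_function A n)%:R : R).

Definition growth_root (n : nat) : R := gamma n `^ n%:R^-1.

Lemma growth_rootX n : (0 < n)%N -> growth_root n ^+ n = gamma n.
Proof.
move=> n0; rewrite -powR_mulrn ?powR_ge0 // -powRrM mulVf ?pnatr_eq0 -?lt0n //.
by rewrite powRr1.
Qed.

Lemma growth_root_ge0 n : 0 <= growth_root n. Proof. exact: powR_ge0. Qed.

Definition growth_inf : R := inf [set growth_root n | n in [set n | (0 < n)%N]].

Lemma growth_inf_le n : (0 < n)%N -> growth_inf <= growth_root n.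
Proof.
move=> n0; apply: ge_inf; last by exists n.
by exists 0 => _ [m _ <-]; apply: growth_root_ge0.
Qed.

Lemma growth_inf_ge c : (forall n, (0 < n)%N -> c <= growth_root n) -> c <= growth_inf.
Proof.
move=> cle; apply: lb_le_inf; first by exists (growth_root 1), 1%N.
by move=> _ [n n0 <-]; apply: cle.
Qed.

(* Fekete: write [n = q m + r] with [m] nearly optimal. *)
Lemma growth_root_eventually (c : R) : growth_inf < c ->
  exists N : nat, forall n, (N <= n)%N -> growth_root n <= c.
Proof.
move=> lec; have [m m0 mc] : exists2 m, (0 < m)%N & growth_root m < c.
  apply: contrapT => no_m; suff : c <= growth_inf by rewrite leNgt lec.
  apply: growth_inf_ge => n n0; rewrite leNgt; apply/negP => nc.
  by apply: no_m; exists n.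
have rm0 : 0 < growth_root m.
  by rewrite powR_gt0 // ltr0n growth_function_gt0.
set e := growth_root m in mc rm0 *.
have ce1 : 1 < c / e by rewrite ltr_pdivlMr ?mul1r.
have [N leN] : exists N : nat, e ^+ m <= (c / e) ^+ N.
  have d0 : 0 < c / e - 1 by rewrite subr_gt0.
  (* Bernoulli: [(c / e) ^+ N] is at least [N * (c / e - 1)], so it suffices that [N] exceed this
     quotient. *)
  exists (Num.truncn (e ^+ m / (c / e - 1))).+1.
  have /ltW := truncnS_gt (e ^+ m / (c / e - 1)).
  rewrite ler_pdivrMr // => /le_trans; apply.
  set N := (Num.truncn _).+1.
  elim: N => [|N IHN]; first by rewrite mul0r expr0.
  have := exprn_ege1 N (ltW ce1); rewrite exprS -natr1.
  by move: ((c / e) ^+ N) IHN => q; nra.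
exists (maxn 1 N) => n; rewrite geq_max => /andP[n0 Nn].
have c0 : 0 < c by apply: lt_trans mc.
rewrite -(@ler_pXn2r _ n) ?nnegrE ?growth_root_ge0 ?(ltW c0) // growth_rootX //.
(* The multiple of [m] costs a power of [e ^+ m = gamma m], the remainder at most one more factor
   [gamma m]; and [e] is at least 1. *)
have le1 : gamma n <= e ^+ n * e ^+ m.
  rewrite {1}(divn_eq n m).
  have : (growth_function A (n %/ m * m + n %% m) <=
      growth_function A m ^ (n %/ m) * growth_function A (n %% m))%N.
    rewrite (leq_trans (growth_functionM _ _)) // leq_mul2r.
    by rewrite mulnC growth_functionX orbT.
  rewrite -(ler_nat R) natrM natrX => /le_trans; apply.
  rewrite [n in e ^+ n](divn_eq n m) exprD mulnC exprM growth_rootX //.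
  rewrite -mulrA ler_wpM2l ?exprn_ge0 ?ler0n //.
  have := growth_function_mono (ltnW (ltn_pmod n m0)).
  rewrite -(ler_nat R) -[gamma m](growth_rootX m0) => /le_trans; apply.
  rewrite ler_peMl ?exprn_ge0 ?(ltW rm0) // exprn_ege1 //.
  rewrite -(@ler_pXn2r _ m) ?nnegrE ?ler01 ?(ltW rm0) // growth_rootX // expr1n.
  by rewrite ler1n growth_function_gt0.
apply: (le_trans le1); have -> : c ^+ n = e ^+ n * (c / e) ^+ n.
  by rewrite -exprMn mulrC divfK ?gt_eqF.
rewrite ler_wpM2l ?exprn_ge0 ?(ltW rm0) // (le_trans leN) //.
by rewrite ler_weXn2l // ltW.
Qed.

Lemma growth_rateE : growth_rate R A = growth_inf.
Proof.
apply: cvg_lim => //; apply/cvgrPdist_le => e e0.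
have [|N leN] := @growth_root_eventually (growth_inf + e); first by rewrite ltrDl.
exists (maxn 1 N) => // n /=; rewrite geq_max => /andP[n0 /leN rn].
rewrite distrC ger0_norm ?subr_ge0 ?growth_inf_le //.
by rewrite lerBlDl.
Qed.

Lemma growth_rate_le_root n : growth_rate R A ^+ n <= gamma n.
Proof.
have [->|n0] := posnP n; first by rewrite expr0 ler1n growth_function_gt0.
rewrite -(growth_rootX n0) growth_rateE lerXn2r ?nnegrE ?growth_root_ge0 ?growth_inf_le //.
by apply: growth_inf_ge => m _; apply: growth_root_ge0.
Qed.

(** Submultiplicativity turns the bound at radius [k * n] into [v ^+ n <= gamma n ^+ k], so every
    term of the infimum is large enough. *)
Lemma growth_rate_ge (v : R) (k : nat) : 1 < v -> (0 < k)%N ->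
  (forall n, v ^+ n <= gamma (k * n)%N) -> v `^ k%:R^-1 <= growth_rate R A.
Proof.
move=> v1 k0 vle; have v0 : 0 <= v by rewrite (le_trans ler01) // ltW.
rewrite growth_rateE; apply: growth_inf_ge => n n0.
have kn0 : (0 < n * k)%N by rewrite muln_gt0 n0.
rewrite -(@ler_pXn2r _ (n * k)) ?nnegrE ?powR_ge0 ?growth_root_ge0 //.
rewrite [in leRHS]exprM growth_rootX // mulnC exprM.
rewrite -[(v `^ _) ^+ k]powR_mulrn ?powR_ge0 // -powRrM mulVf ?pnatr_eq0 -?lt0n //.
rewrite powRr1 // (le_trans (vle n)) // -natrX ler_nat mulnC growth_functionX //.
Qed.

Lemma growth_rate_ge0 : 0 <= growth_rate R A.
Proof. by rewrite growth_rateE; apply: growth_inf_ge => n _; apply: growth_root_ge0. Qed.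

End Fekete.

End Balls.

(** * The extension [K ><|_alpha Z] *)

Section HNNExtension.
Variables (K : groupType) (alpha : automorphism K).
Local Notation G := (hnn alpha).
Local Notation base := (@hnn_base K alpha).
Local Notation t := (hnn_t alpha).

Lemma hnn_base_inj : injective base. Proof. by move=> k l []. Qed.

Lemma hnn_mulE (g h : G) : (g * h)%g = (g.1 * aut_pow alpha g.2 h.1, g.2 + h.2)%g :> G.
Proof. by []. Qed.

Lemma hnn_invE (g : G) : (g^-1)%g = (aut_pow alpha (- g.2) (g.1^-1)%g, - g.2) :> G.
Proof. by []. Qed.

Lemma hnn_mul_pair k l (m n : int) :
  (((k, m) : G) * ((l, n) : G))%g = ((k * aut_pow alpha m l)%g, m + n) :> G.
Proof. by []. Qed.

Lemma hnn_baseX k n : base (k ^+ n)%g = (base k ^+ n)%g.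
Proof. by elim: n => // n IHn; rewrite !expgS hnn_baseM IHn. Qed.

Lemma hnn_baseV k : base (k^-1)%g = (base k)^-1%g.
Proof. by apply: (@mulgI _ (base k)); rewrite -hnn_baseM !mulgV. Qed.

Lemma hnn_expg2 (g : G) n : (g ^+ n)%g.2 = g.2 *+ n.
Proof. by elim: n => // n IHn; rewrite expgS hnn_mulE /= IHn mulrS. Qed.

Lemma hnn_finitely_generated :
  finitely_generated [set: K] -> finitely_generated [set: G].
Proof.
case=> A genA; pose B : {fset G} := (t |` [fset base a | a in A])%fset.
have sB : is_subgroup (generated B) by apply: subgroup_span_subgroup.
exists B; apply/seteqP; split=> // -[k n] _.
have base_k l : generated B (base l).
  have sP : is_subgroup [set l | generated B (base l)].
    split; first exact: (subgroup1 sB).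
    by move=> l1 l2 B1 B2 /=; rewrite hnn_baseM hnn_baseV; apply: sB.2.
  have : generated A l by rewrite genA.
  apply: (subgroup_span_min sP) => a aA; apply: sub_subgroup_span => /=.
  by rewrite !inE; apply/orP; right; apply/imfsetP; exists a.
have Bt : generated B t by apply: sub_subgroup_span; rewrite /= !inE eqxx.
have t_n : generated B ((1%g, n) : G).
  elim: n => [|n IHn|n IHn]; first exact: (subgroup1 sB).
    have -> : ((1%g, n.+1%:Z) : G) = (((1%g, n%:Z) : G) * t)%g.
      by rewrite hnn_mul_pair aut_pow1 mulg1 -PoszD addn1.
    exact: (subgroupM sB).
  have -> : ((1%g, - n.+1%:Z) : G) = (((1%g, - n%:Z) : G) / t)%g.
    rewrite hnn_invE invg1 aut_pow1 hnn_mul_pair aut_pow1 mulg1.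
    by rewrite -addn1 PoszD opprD.
  exact: (sB.2).
have -> : ((k, n) : G) = (base k * ((1%g, n) : G))%g by rewrite hnn_mulE /= mulg1 add0r.
exact: (subgroupM sB).
Qed.

Section Generators.
Variable A : {fset G}.
Hypothesis A_generates : generated A = [set: G].

(** Otherwise [A] would lie in the base subgroup, which misses [t]. *)
Lemma exists_nonzero_exponent : exists2 s : G, s \in A & s.2 != 0.
Proof.
apply: contrapT => no_s.
have sH : is_subgroup [set g : G | g.2 = 0].
  by split=> // g h /= g0 h0; rewrite g0 h0 oppr0 addr0.
have : generated A t by rewrite A_generates.
move/(subgroup_span_min sH) => /(_ _)/= t0.
have: (1 : int) = 0; last by [].
apply: t0 => g gA /=; apply: contrapT => /eqP g0; apply: no_s; exists g => //.
Qed.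

(** If the generators commuted, [t] would commute with the base, so [alpha] would fix a nontrivial
    element, a periodic class with [n = 1]. *)
Lemma exists_noncommuting :
  (exists x : K, x != 1%g) -> ~ has_periodic_conjugacy_class alpha ->
  exists a b : G, [/\ a \in A, b \in A & ~ commute a b].
Proof.
case=> k k1 no_per; apply: contrapT => no_ab; apply: no_per; exists k, 1.
split=> //; exists 1%g; rewrite conjg1 /=.
have A_comm (g h : G) : [set` A] g -> [set` A] h -> commute g h.
  by move=> gA hA; apply: contrapT => gh; apply: no_ab; exists g, h.
have genT g : subgroup_span [set` A] g by rewrite -[subgroup_span _]/(generated A) A_generates.
have := subgroup_span_commutative A_comm (genT t) (genT (base k)).
by rewrite /commute !hnn_mulE /= mul1g mulg1 => -[].
Qed.

End Generators.

Section Conjugation.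
Variable s : G.

(** Conjugation by [s] on the base, in coordinates. *)
Definition base_conj (k : K) : K := (s.1 * aut_pow alpha s.2 k * s.1^-1)%g.
Definition base_conjV (k : K) : K := aut_pow alpha (- s.2) (s.1^-1 * k * s.1)%g.

Lemma base_conjM : {morph base_conj : k l / (k * l)%g}.
Proof. by move=> k l; rewrite /base_conj aut_powM !mulgA mulgVK. Qed.

Lemma base_conjK : cancel base_conj base_conjV.
Proof. by move=> k; rewrite /base_conj /base_conjV !mulgA mulVg mul1g mulgVK aut_powK. Qed.

Lemma base_conjVK : cancel base_conjV base_conj.
Proof.
move=> k; rewrite /base_conj /base_conjV -aut_powD subrr /=.
by rewrite !mulgA mulgV mul1g mulgK.
Qed.

Definition base_aut : automorphism K :=
  Automorphism base_conjM base_conjK base_conjVK.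

Lemma base_autE k : (s * base k)%g = (base (base_aut k) * s)%g.
Proof. by rewrite !hnn_mulE /= /base_conj mulgVK addr0 add0r. Qed.

Lemma base_aut_powE (n : nat) k :
  (s ^+ n * base k)%g = (base (aut_pow base_aut n%:Z k) * s ^+ n)%g.
Proof.
elim: n k => [|n IHn] k; first by rewrite mul1g mulg1.
by rewrite expgS -mulgA IHn mulgA base_autE -mulgA.
Qed.

(** If [s ^+ n] centralizes [v], then the power of [alpha] given by its exponent [s.2 *+ n] maps [v]
    to a conjugate of [v] by its component in [K]. *)
Lemma fixed_periodic (n : nat) v : s.2 != 0 -> (0 < n)%N -> v != 1%g ->
  aut_pow base_aut n%:Z v = v -> has_periodic_conjugacy_class alpha.
Proof.
move=> s0 n0 v1 vn; exists v, (s.2 *+ n); split=> //.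
  by rewrite mulrn_eq0 negb_or -lt0n n0.
exists (s ^+ n)%g.1; have := base_aut_powE n v; rewrite vn !hnn_mulE => -[eq1 _].
rewrite -hnn_expg2; apply: (@mulgI _ (s ^+ n)%g.1).
by rewrite eq1 /conjg mulVKg.
Qed.

Variables (A : {fset G}) (x : K).
Hypothesis sA : s \in A.
Hypothesis x_ball : ball A 4 (base x).

Lemma orbit_ball (i : nat) : ball A (4 + 2 * i) (base (aut_pow base_aut i%:Z x)).
Proof.
have -> : base (aut_pow base_aut i%:Z x) = (s ^+ i * base x * (s ^+ i)^-1)%g.
  by rewrite base_aut_powE mulgK.
have Bs : ball A i (s ^+ i)%g by have := ballX i (ball_generator sA); rewrite mul1n.
have -> : (4 + 2 * i = i + 4 + i)%N by lia.
by apply: ballM; [apply: ballM|apply: ballV].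
Qed.

(** This is the word [x^{e_0} s^m x^{e_1} s^m ...] with the powers of [s] moved to the right; each
    letter costs at most [4 + m]. *)
Lemma word_ball (m : nat) (w : seq bool) :
  ball A ((4 + m) * size w) (base (word_product base_aut x m w) * s ^+ (m * size w))%g.
Proof.
elim: w => [|b w IHw]; first by rewrite /= !muln0 mulg1; apply: ball1.
have -> : (base (word_product base_aut x m (b :: w)) * s ^+ (m * size (b :: w)))%g =
    (base x ^+ b * s ^+ m * (base (word_product base_aut x m w) * s ^+ (m * size w)))%g.
  rewrite -[word_product _ _ _ (b :: w)]/(x ^+ b * aut_pow base_aut m%:Z (word_product base_aut x m w))%g.
  rewrite hnn_baseM hnn_baseX -!mulgA; congr (_ * _)%g.
  by rewrite [(s ^+ m * (_ * _))%g]mulgA base_aut_powE -mulgA -expgnDr mulnS.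
rewrite [size _]/= mulnS; apply: ballM IHw; apply: ballM.
  by case: b; rewrite expgb //; apply: ball1.
by have := ballX m (ball_generator sA); rewrite mul1n.
Qed.

(** The [2 ^ n] words share the same final power of [s], so distinct factors in [K] give distinct
    elements. *)
Lemma growth_of_distinct_words (m n : nat) :
  (forall w1 w2 : seq bool, size w1 = size w2 -> w1 != w2 ->
     word_product base_aut x m w1 <> word_product base_aut x m w2) ->
  (2 ^ n <= growth_function A ((4 + m) * n))%N.
Proof.
move=> words_distinct.
pose g (w : n.-tuple bool) := (base (word_product base_aut x m w) * s ^+ (m * n))%g.
have -> : (2 ^ n = size [seq g w | w : n.-tuple bool])%N.
  by rewrite size_map -cardE card_tuple card_bool.
apply: growth_function_ge => [|_ /mapP[w _ ->]]; last first.
  by have := word_ball m w; rewrite size_tuple.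
rewrite map_inj_uniq ?enum_uniq // => w1 w2 /mulIg/hnn_base_inj eqw.
apply: contrapT => neq; apply: (words_distinct w1 w2) => //; first by rewrite !size_tuple.
by apply/eqP => eqw12; apply/neq/val_inj.
Qed.

Lemma growth_of_orbit_subgroup (d n : nat) :
  (growth_function [fset aut_pow base_aut i%:Z x | i in iota 0 d.+1]%fset n <=
   growth_function A ((4 + 2 * d) * n))%N.
Proof.
set B := [fset _ | _ in _]%fset.
have B_ball k : k \in B -> ball A (4 + 2 * d) (base k).
  case/imfsetP => i id ->; have {}id : (i <= d)%N.
    by have : i \in iota 0 d.+1 := id; rewrite mem_iota.
  by apply: ball_mono (orbit_ball i); rewrite leq_add2l leq_mul2l.
have balls k : ball B n k -> ball A ((4 + 2 * d) * n) (base k).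
  case=> w [wn wB ->]; apply: (@ball_mono _ _ ((4 + 2 * d) * size w)).
    by rewrite leq_mul2l wn orbT.
  elim: w wB {wn} => [|l w IHw] wB; first by rewrite big_nil; apply: ball1.
  rewrite big_cons hnn_baseM mulnS; apply: ballM; last first.
    by apply: IHw => y yw; apply: wB; rewrite inE yw orbT.
  have [/B_ball //|/B_ball] := wB l (mem_head _ _).
  by rewrite hnn_baseV => /ballV; rewrite invgK.
rewrite /growth_function -[size (fset_set (ball B n))](size_map base).
apply: growth_function_ge; first by rewrite map_inj_uniq ?fset_uniq //; exact: hnn_base_inj.
by move=> _ /mapP[k + ->]; have -> := mem_ball B n k => /set_mem; apply: balls.
Qed.

End Conjugation.
End HNNExtension.

(** * The uniform lower bound *)

Lemma growth_constant_le (G : groupType) (R : realType) (H : set G) (A : {fset G}) :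
  generated A = H -> growth_constant R H <= growth_rate R A.
Proof.
move=> AH; apply: ge_inf; last by exists A.
by exists 0 => _ [B _ <-]; apply: growth_rate_ge0.
Qed.

Lemma gt1_powRV (R : realType) (v : R) (k : nat) : 1 < v -> (0 < k)%N -> 1 < v `^ k%:R^-1.
Proof.
move=> v1 k0; suff : 1 `^ k%:R^-1 < v `^ k%:R^-1 by rewrite powR1.
rewrite gt0_ltr_powR ?nnegrE //.
- by rewrite invr_gt0 ltr0n.
- by rewrite (le_trans ler01) // ltW.
Qed.

Theorem theorem5p3 (R : realType) (u : R) (d : nat) (u_gt1 : 1 < u)
    (d_gt0 : (0 < d)%N) :
  exists2 k : R, 1 < k &
    forall K : groupType,
      (exists x : K, x != 1%g) ->
      finitely_generated [set: K] ->
      torsion_free K ->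
      (forall H : set K, is_subgroup H -> finitely_generated H ->
         u <= growth_constant R H \/
         exists2 n : nat, (n <= d)%N & isomorphic_to_Zn n H) ->
      forall alpha : automorphism K,
        ~ has_periodic_conjugacy_class alpha ->
        k <= growth_constant R [set: hnn alpha].
Proof.
have [B periodicB] := periodic_element d_gt0.
(* The first bound comes from a fast-growing [<x_0, ..., x_d>], whose generators have length at most
   [4 + 2 * d]; the second from distinct words with some [m <= B], at cost at most [4 + B] per
   letter. *)
exists (Num.min (u `^ (4 + 2 * d)%:R^-1) (2 `^ (4 + B)%:R^-1)).
  by rewrite lt_min !gt1_powRV // ltr1n.
move=> K K1 K_fg K_tf K_sub alpha no_per.
(* An infimum over the empty set would be 0, so a finite generating set of the extension is
   exhibited first. *)
apply: lb_le_inf.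
  by have [A genA] := hnn_finitely_generated alpha K_fg; exists (growth_rate R A), A.
move=> _ [A /= genA <-].
have [s sA s0] := exists_nonzero_exponent genA.
have [a [b [aA bA ab]]] := exists_noncommuting genA K1 no_per.
pose x : K := [~ a, b]%g.1.
(* The exponents of [t] cancel in a commutator, which therefore lies in the base. *)
have def_x : hnn_base alpha x = [~ a, b]%g.
  rewrite /x /hnn_base [RHS]surjective_pairing; congr pair.
  by rewrite /commg /conjg !hnn_mulE !hnn_invE /=; lia.
have x1 : x != 1%g.
  apply/eqP => x1; apply/ab/commgP; rewrite -def_x x1; exact: eqxx.
have x_ball : ball A 4 (hnn_base alpha x).
  have gen := ball_generator; rewrite def_x /commg /conjg.
  apply: (@ballM _ _ 1 3); first exact/ballV/gen.
  apply: (@ballM _ _ 1 2); first exact/ballV/gen.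
  by apply: (@ballM _ _ 1 1); apply: gen.
rewrite ge_min; apply/orP; apply: contrapT => /not_orP[small_u small_2].
set beta := base_aut s in x_ball.
pose S : {fset K} := [fset aut_pow beta i%:Z x | i in iota 0 d.+1]%fset.
have sS : is_subgroup (generated S) by apply: subgroup_span_subgroup.
have [u_le|[n nd Zn]] := K_sub _ sS (ex_intro _ S erefl).
  apply: small_u; apply: growth_rate_ge => // n.
  rewrite (le_trans (lerXn2r n _ _ (le_trans u_le (growth_constant_le R erefl)))) //.
  - by rewrite nnegrE (le_trans ler01) // ltW.
  - by rewrite nnegrE growth_rate_ge0.
  by rewrite (le_trans (growth_rate_le_root _ _ _)) // ler_nat growth_of_orbit_subgroup.
have orbit_S (i : nat) : (i <= d)%N -> generated S (aut_pow beta i%:Z x).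
  move=> id; have id' : i \in iota 0 d.+1 by rewrite mem_iota.
  by apply: sub_subgroup_span; apply/imfsetP; exists i.
have [P [sP cP relP]] :=
  @isomorphic_to_Zn_relation _ n d _ (fun i => aut_pow beta i%:Z x) Zn nd orbit_S.
have [|m /andP[m0 mB]|N [v [N0 v1 vN]]] := periodicB K beta x P K_tf x1 sP cP _ relP.
- by move=> i j id jd; apply: (isomorphic_to_Zn_commute Zn); apply: orbit_S.
(* Without a collision for this [m], the [2 ^ n'] words of length [n'] are distinct and would yield
   the second bound. *)
- apply: contrapT => distinct; apply: small_2.
  apply: growth_rate_ge => [||n']; rewrite ?ltr1n // -natrX ler_nat.
  apply: (@leq_trans (growth_function A ((4 + m) * n'))); last first.
    by apply: growth_function_mono; rewrite leq_mul2r leq_add2l mB orbT.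
  apply: (growth_of_distinct_words sA x_ball) => w1 w2 sz neq eqw.
  by apply: distinct; exists w1, w2.
- by apply: no_per; apply: fixed_periodic s0 N0 v1 vN.
Qed.
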